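(* For every commutative $\mathbb{Q}$-algebra $R$, the following maps are isomorphisms of abelian groups, natural in $R$: $\mathcal{F}:(\mathfrak{G}^1_+(R),\boxtimes)\to(\Lambda(R),\cdot)$; $\ \mathcal{S}_V:(\mathfrak{G}^1_+(R),\boxtimes_V)\to(\Lambda(R),\cdot)$; $\ \frac{d}{dz}\log:(\Lambda(R),\cdot)\to(R[[z]],+)$; $\ -\boxtimes\operatorname{Zeta}_1:(\mathfrak{G}^1_+(R),\boxtimes)\to(\mathfrak{G}^1_+(R),\boxtimes_V)$; $\ -\boxtimes\operatorname{Zeta}_1:(\mathfrak{M}^1(R),+)\to(\mathfrak{M}^1(R),\boxplus_V)$; $\ \mathcal{R}_V:(\mathfrak{M}^1(R),\boxplus_V)\to(R[[z]],+)$; $\ \operatorname{EXP}:(\mathfrak{M}^1(R),+)\to(\mathfrak{G}^1_+(R),\boxtimes)$; $\ \operatorname{EXP}_V:(\mathfrak{M}^1(R),\boxplus_V)\to(\mathfrak{G}^1_+(R),\boxtimes_V)$. Moreover the diagram they form commutes, i.e. for all $f\in\mathfrak{G}^1_+(R)$ and $m\in\mathfrak{M}^1(R)$: $\mathcal{S}_V(f\boxtimes\operatorname{Zeta}_1)=\mathcal{F}(f)$; $\ \mathcal{R}_V(m\boxtimes\operatorname{Zeta}_1)=m$; $\ \frac{d}{dz}\log\mathcal{F}(\operatorname{EXP}(m))=m$; $\ \frac{d}{dz}\log\mathcal{S}_V(\operatorname{EXP}_V(m))=\mathcal{R}_V(m)$; and $\operatorname{EXP}_V(m\boxtimes\operatorname{Zeta}_1)=\operatorname{EXP}(m)\boxtimes\operatorname{Zeta}_1$.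 Here $\mathfrak{M}^1(R)$ and $R[[z]]$ are identified as additive groups as described in the context.
   Context: $R$ is a commutative unital ring. $\mathfrak{M}^1(R)=zR[[z]]$ (power series $f=\sum_{n\ge1}\alpha_nz^n$), $\mathfrak{G}^1_+(R)=\{f\in zR[[z]]:\alpha_1=1\}$, $\Lambda(R)=1+zR[[z]]$ with multiplication of power series. $(\mathfrak{M}^1(R),+)$ is identified with $(R[[z]],+)$ through $\sum_{n\ge1}\alpha_nz^n\leftrightarrow\sum_{n\ge1}\alpha_nz^{n-1}$ (both being $R^{\mathbb{N}}$); this identification is suppressed in the notation. $\operatorname{NC}(n)$ is the set of non-crossing partitions of $\{1,\dots,n\}$. The Kreweras complement $K(\pi)$ of $\pi\in\operatorname{NC}(n)$ is the maximal (for the order in which $\sigma\le\pi$ iff every block of $\sigma$ lies in a block of $\pi$) non-crossing partition of $\{\bar1,\dots,\bar n\}$ (identified with $\{1,\dots,n\}$) such that $\pi\cup K(\pi)$ is a non-crossing partition of $1<\bar1<2<\dots<n<\bar n$. Boxed convolution on $zR[[z]]$: for $f=\sum\alpha_nz^n$, $g=\sum\beta_nz^n$, the $n$-th coefficient of $f\boxtimes g$ is $\sum_{\pi\in\operatorname{NC}(n)}\prod_{V\in\pi}\alpha_{|V|}\prod_{W\in K(\pi)}\beta_{|W|}$. It is associative with unit $z$. $\operatorname{Zeta}_1=\sum_{n\ge1}z^n$, and $\operatorname{Moeb}_1$ is its $\boxtimes$-inverse. $f\boxplus_Vg:=(f\boxtimes\operatorname{Moeb}_1+g\boxtimes\operatorname{Moeb}_1)\boxtimes\operatorname{Zeta}_1$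 and $f\boxtimes_Vg:=f\boxtimes\operatorname{Moeb}_1\boxtimes g$. With $f^{-1}$ the compositional inverse of $f$: $\mathcal{F}(f)=\frac1zf^{-1}(z)$ and $\mathcal{S}_V(f)=\frac{1+z}{z}f^{-1}(z)$. $\frac{d}{dz}\log u=u'/u$. $\mathcal{R}_V(m)=m\boxtimes\operatorname{Moeb}_1$. $\operatorname{LOG}(f):=\frac{d}{dz}\log(\mathcal{F}(f))$ for $f\in\mathfrak{G}^1_+(R)$ (viewed in $\mathfrak{M}^1(R)$), $\operatorname{EXP}:=\operatorname{LOG}^{-1}$, and $\operatorname{EXP}_V(m):=\operatorname{EXP}(m\boxtimes\operatorname{Moeb}_1)\boxtimes\operatorname{Zeta}_1$. *)

(* Defs.v *)
From HB Require Import structures.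
From mathcomp Require Import all_boot all_order all_algebra.
From Stdlib Require Import ClassicalEpsilon.
Set Implicit Arguments.
Unset Strict Implicit.
Unset Printing Implicit Defensive.
Import GRing.Theory.
Local Open Scope ring_scope.

(* A commutative Q-algebra is a [comPzRingType] R (the zero ring is allowed)
   with a ring morphism rat -> R.  Such a morphism is unique when it exists, so
   every ring morphism between Q-algebras is a Q-algebra morphism. *)

Section NonCrossing.

Variables (T : finType) (rk : T -> nat).

Definition noncrossing (P : {set {set T}}) : bool :=
  [forall A in P, forall B in P,
     [forall a in A, forall c in A, forall b in B, forall d in B,
        [&& rk a < rk b, rk b < rk c & rk c < rk d]%N ==> (A == B)]].

(* Non-crossing partitions of T, linearly ordered by the injection rk. *)
Definition nc_partition (P : {set {set T}}) : bool :=
  partition P [set: T] && noncrossing P.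

(* The order on partitions: every block of P lies in a block of Q. *)
Definition refines (P Q : {set {set T}}) : bool :=
  [forall A in P, exists B in Q, A \subset B].

End NonCrossing.

(* {1, ..., n} is represented by 'I_n = {0, ..., n-1}. *)
Definition NC (n : nat) : {set {set {set 'I_n}}} :=
  [set P | nc_partition (@nat_of_ord n) P].

(* inl i stands for i and inr i for its barred copy; the rank is the position in
   1 < bar 1 < 2 < ... < n < bar n. *)
Definition interleave_rank (n : nat) (x : 'I_n + 'I_n) : nat :=
  match x with inl i => i.*2 | inr i => i.*2.+1 end.

Definition interleave (n : nat) (P Q : {set {set 'I_n}}) :
    {set {set ('I_n + 'I_n)%type}} :=
  [set inl @: (A : {set 'I_n}) | A in P] :|:
  [set inr @: (B : {set 'I_n}) | B in Q].

Definition kreweras_compatible (n : nat) (P Q : {set {set 'I_n}}) : bool :=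
  (Q \in NC n) && nc_partition (@interleave_rank n) (interleave P Q).

(* The greatest Q such that P together with Q is non-crossing on the doubled set.
   The default set0 is never reached for P \in NC n. *)
Definition kreweras (n : nat) (P : {set {set 'I_n}}) : {set {set 'I_n}} :=
  odflt set0 [pick Q | kreweras_compatible P Q &
    [forall Q' : {set {set 'I_n}}, kreweras_compatible P Q' ==> refines Q' Q]].

(* f : fps R is the series \sum_n (f n) z^n. *)
Definition fps (R : Type) : Type := nat -> R.

Definition fps_map (R S : Type) (h : R -> S) (f : fps R) : fps S :=
  fun n => h (f n).

Section Series.

Variable R : comPzRingType.
Implicit Types f g u v m : fps R.

Definition fps_add f g : fps R := fun n => f n + g n.

Definition fps_mul f g : fps R :=
  fun n => \sum_(i < n.+1) f i * g (n - i)%N.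

Definition fps_one : fps R := fun n => (n == 0%N)%:R.

Definition fps_z : fps R := fun n => (n == 1%N)%:R.

Definition fps_exp f (k : nat) : fps R := iter k (fps_mul f) fps_one.

(* f(g(z)), meaningful for g with zero constant term: then g^k contributes
   nothing to the coefficient of z^n for k > n. *)
Definition fps_comp f g : fps R :=
  fun n => \sum_(k < n.+1) f k * fps_exp g k n.

Definition fps_deriv f : fps R := fun n => f n.+1 *+ n.+1.

(* Division by z of a series without constant term.  This is also the additive
   identification of M1 = z R[[z]] with R[[z]]; fps_mulz is its inverse. *)
Definition fps_divz f : fps R := fun n => f n.+1.

Definition fps_mulz f : fps R := fun n => if n is k.+1 then f k else 0.

Definition fps_all : {pred fps R} := [pred f : fps R | true].
Definition M1 : {pred fps R} := [pred f : fps R | f 0%N == 0].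
Definition G1 : {pred fps R} := [pred f : fps R | (f 0%N == 0) && (f 1%N == 1)].
Definition Lambda : {pred fps R} := [pred f : fps R | f 0%N == 1].

(* The inverse series, for u with invertible constant term. *)
Definition fps_inv u : fps R :=
  epsilon (inhabits u) (fun v => fps_mul u v = fps_one).

(* The compositional inverse, for f in G1. *)
Definition fps_compinv f : fps R :=
  epsilon (inhabits f)
    (fun g => [/\ g \in M1, fps_comp f g = fps_z & fps_comp g f = fps_z]).

Definition boxtimes f g : fps R := fun n =>
  if (0 < n)%N then
    \sum_(P in NC n) (\prod_(V in P) f #|V|) * \prod_(W in kreweras P) g #|W|
  else 0.

Definition Zeta1 : fps R := fun n => (0 < n)%N%:R.

Definition Moeb1 : fps R :=
  epsilon (inhabits Zeta1)
    (fun g => [/\ g \in M1, boxtimes Zeta1 g = fps_z & boxtimes g Zeta1 = fps_z]).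

Definition boxplusV f g : fps R :=
  boxtimes (fps_add (boxtimes f Moeb1) (boxtimes g Moeb1)) Zeta1.

Definition boxtimesV f g : fps R := boxtimes (boxtimes f Moeb1) g.

Definition mul_Zeta1 f : fps R := boxtimes f Zeta1.

Definition calF f : fps R := fps_divz (fps_compinv f).

Definition S_V f : fps R :=
  fps_mul (fps_add fps_one fps_z) (fps_divz (fps_compinv f)).

Definition dlog u : fps R := fps_mul (fps_deriv u) (fps_inv u).

(* R_V takes its values in R[[z]], LOG takes its values in M1. *)
Definition R_V m : fps R := fps_divz (boxtimes m Moeb1).

Definition LOG f : fps R := fps_mulz (dlog (calF f)).

Definition EXP m : fps R :=
  epsilon (inhabits m) (fun f => f \in G1 /\ LOG f = m).

Definition EXP_V m : fps R := boxtimes (EXP (boxtimes m Moeb1)) Zeta1.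

End Series.

Arguments fps_one R : clear implicits.
Arguments fps_z R : clear implicits.
Arguments fps_all R : clear implicits.
Arguments M1 R : clear implicits.
Arguments G1 R : clear implicits.
Arguments Lambda R : clear implicits.
Arguments Zeta1 R : clear implicits.
Arguments Moeb1 R : clear implicits.

Definition abelian_group_on (T : Type) (A : {pred T}) (op : T -> T -> T) : Prop :=
  [/\ {in A &, forall x y, op x y \in A},
      {in A & &, associative op},
      {in A &, commutative op} &
      exists2 e, e \in A &
        {in A, left_id e op} /\
        {in A, forall x, exists2 y, y \in A & op y x = e}].

Definition group_iso (T U : Type) (A : {pred T}) (opA : T -> T -> T)
    (B : {pred U}) (opB : U -> U -> U) (phi : T -> U) : Prop :=
  [/\ abelian_group_on A opA /\ abelian_group_on B opB,
      {homo phi : x / x \in A >-> x \in B},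
      {in A &, {morph phi : x y / opA x y >-> opB x y}},
      {in A &, injective phi} &
      {in B, forall y, exists2 x, x \in A & phi x = y}].

Definition group_hom (T U : Type) (A : {pred T}) (opA : T -> T -> T)
    (B : {pred U}) (opB : U -> U -> U) (phi : T -> U) : Prop :=
  {homo phi : x / x \in A >-> x \in B} /\
  {in A &, {morph phi : x y / opA x y >-> opB x y}}.

(* An isomorphism between two functors (A, opA) and (B, opB) from commutative
   Q-algebras to abelian groups, both acting on morphisms coefficientwise. *)
Definition natural_group_iso
    (A : forall R : comPzRingType, {pred fps R})
    (opA : forall R : comPzRingType, fps R -> fps R -> fps R)
    (B : forall R : comPzRingType, {pred fps R})
    (opB : forall R : comPzRingType, fps R -> fps R -> fps R)
    (phi : forall R : comPzRingType, fps R -> fps R) : Prop :=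
  (forall (R : comPzRingType) (iR : {rmorphism rat -> R}),
     group_iso (A R) (@opA R) (B R) (@opB R) (@phi R)) /\
  (forall (R S : comPzRingType) (iR : {rmorphism rat -> R})
     (iS : {rmorphism rat -> S}) (h : {rmorphism R -> S}),
     [/\ group_hom (A R) (@opA R) (A S) (@opA S) (fps_map h),
         group_hom (B R) (@opB R) (B S) (@opB S) (fps_map h) &
         {in A R, forall f, fps_map h (phi R f) = phi S (fps_map h f)}]).

(* Main.v *)
Require Import Defs.
From HB Require Import structures.
From mathcomp Require Import all_boot all_order all_algebra.
From mathcomp Require Import zify boolp.
Set Implicit Arguments.
Unset Strict Implicit.
Unset Printing Implicit Defensive.
Import GRing.Theory.
Local Open Scope ring_scope.

(* Let j be the element following 0 in its block (j = n if there is none).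
   Splitting a non-crossing partition of {0, ..., n-1} into its restrictions to
   ]0, j[ and [j, n[ identifies NC(n) with the binary trees with n nodes; block
   sizes and Kreweras block sizes are both read off the two subtrees.  The
   resulting recursion gives, for all f and g, series P and Q without constant
   term such that
     P = z (g/z)(Q),   Q = z (f/z)(P),   f [x] g = z (f/z)(P) (g/z)(Q).
   For f, g in M1, f [x] g = f(P) = g(Q) and P Q = z (f [x] g).  For f, g in G1, composing
   with the inverse of f [x] g turns the last identity into
   F(f [x] g) = F(f) F(g).  If f is only in M1, then H = f [x] g is still the
   unique solution of H = f(P), P F(g)(H) = z, which makes right boxed
   convolution by G1 an action on M1; multiplying by Zeta and Moeb is then
   invertible on M1.  Since F(Moeb) = 1 + z, S_V(f) = F(f [x] Moeb), and every
   other map is determined by F, S_V, R_V and dlog. *)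

(** * The ring of formal power series *)

(** A convertible alias of [fps R] that carries the ring structure, so that ring operations unfold
    to those of the statement. Equality test and choice are classical. *)
Definition series (R : comPzRingType) : Type := fps R.

HB.instance Definition _ (R : comPzRingType) := gen_eqMixin (series R).
HB.instance Definition _ (R : comPzRingType) := gen_choiceMixin (series R).

Section SeriesRing.
Variable R : comPzRingType.
Implicit Types f g h : fps R.

Let fps0 : fps R := fun=> 0.
Let fps_opp f : fps R := fun n => - f n.

Fact fps_addA : associative (@fps_add R).
Proof. by move=> f g h; apply/funext => n; apply: addrA. Qed.
Fact fps_addC : commutative (@fps_add R).
Proof. by move=> f g; apply/funext => n; apply: addrC. Qed.
Fact fps_add0 : left_id fps0 (@fps_add R).
Proof. by move=> f; apply/funext => n; apply: add0r. Qed.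
Fact fps_addN : left_inverse fps0 fps_opp (@fps_add R).
Proof. by move=> f; apply/funext => n; apply: addNr. Qed.

HB.instance Definition _ :=
  GRing.isZmodule.Build (series R) fps_addA fps_addC fps_add0 fps_addN.

Fact fps_mulC : commutative (@fps_mul R).
Proof.
move=> f g; apply/funext => n; rewrite /fps_mul (reindex_inj rev_ord_inj) /=.
by apply: eq_bigr => i _; rewrite subSS subKn ?leq_ord// mulrC.
Qed.

Fact fps_mulA : associative (@fps_mul R).
Proof.
move=> f g h; apply/funext => n; rewrite /fps_mul.
(* [j] is the degree taken from [f] and [k] the total degree taken from [f] and [g]; both sides sum
   [F j k] over [j <= k <= n]. *)
pose F j k := f j * g (k - j)%N * h (n - k)%N.
transitivity (\sum_(j < n.+1) \sum_(k < n.+1 | (j <= k)%N) F j k).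
  apply: eq_bigr => j _; rewrite -(big_geq_mkord j n.+1 xpredT (F j)).
  rewrite -[in RHS](add0n (val j)) big_addn subSn ?leq_ord// big_mkord big_distrr.
  by apply: eq_bigr => k _; rewrite /F /= add0n addnK mulrA addnC subnDA.
rewrite (exchange_big_dep predT)//=; apply: eq_bigr => k _.
rewrite (big_ord_narrow_leq (leq_ord k)) big_distrl.
by apply: eq_bigr.
Qed.

Fact fps_mul1 : left_id (fps_one R) (@fps_mul R).
Proof.
move=> f; apply/funext => n; rewrite /fps_mul big_ord_recl big1 ?addr0 /= ?subn0.
  by rewrite /fps_one mul1r.
by move=> i _; rewrite /fps_one mul0r.
Qed.

Fact fps_mulDl : left_distributive (@fps_mul R) (@fps_add R).
Proof.
move=> f g h; apply/funext => n; rewrite /fps_mul /fps_add -big_split.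
by apply: eq_bigr => i _; rewrite mulrDl.
Qed.

HB.instance Definition _ := GRing.Zmodule_isComPzRing.Build (series R)
  fps_mulA fps_mulC fps_mul1 fps_mulDl.

Lemma fps_expE f k : fps_exp f k = (f : series R) ^+ k.
Proof. by elim: k => // k IH; rewrite exprS -IH. Qed.

End SeriesRing.

(** * Truncated agreement, composition and inversion of power series *)

Section SeriesTheory.
Variable R : comPzRingType.
Implicit Types f g h u v w : series R.

Local Notation "'Z" := (fps_z R : series R).
Local Notation D := (@fps_divz R : series R -> series R).
Local Infix "\oc" := (@fps_comp R : series R -> series R -> series R) (at level 35).

(** Congruence modulo [z^n]. Identities between series are proved by induction on this precision. *)
Definition agree n u v := forall i, (i < n)%N -> u i = v i.

Lemma agree_eq u v : (forall n, agree n u v) -> u = v.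
Proof. by move=> h; apply/funext => n; apply: (h n.+1). Qed.

Lemma agree_le m n u v : (m <= n)%N -> agree n u v -> agree m u v.
Proof. by move=> le_mn h i lt_im; apply: h; apply: leq_trans le_mn. Qed.

Lemma agree_add n u v u' v' :
  agree n u u' -> agree n v v' -> agree n (u + v) (u' + v').
Proof. by move=> hu hv i lt_in; congr (_ + _); [apply: hu|apply: hv]. Qed.

Lemma agree_mul n u v u' v' :
  agree n u u' -> agree n v v' -> agree n (u * v) (u' * v').
Proof.
move=> hu hv i lt_in; apply: eq_bigr => j _; rewrite hu ?hv//.
  by apply: leq_ltn_trans lt_in; apply: leq_subr.
by apply: leq_ltn_trans lt_in; rewrite -ltnS.
Qed.

Lemma agree_exp n u v k : agree n u v -> agree n (u ^+ k) (v ^+ k).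
Proof.
by move=> h; elim: k => // k IH; rewrite !exprS; apply: agree_mul.
Qed.

(** A factor without constant term gains one degree of precision: the term of index 0 vanishes and
    the others read [u] and [v] below [n]. Inductions on precision and contractions rest on this
    gain. *)
Lemma agree_mul_M1 n w u v :
  w 0%N = 0 -> agree n u v -> agree n.+1 (w * u) (w * v).
Proof.
move=> w0 h i lt_in; apply: eq_bigr => -[[|j] /= lt_j] _; first by rewrite w0 !mul0r.
congr (_ * _); apply: h; case: i lt_in lt_j => // i; rewrite !ltnS subSS => lt_in _.
by apply: leq_ltn_trans lt_in; apply: leq_subr.
Qed.

Lemma agree_comp n u v f g : agree n u v -> agree n f g ->
  agree n (u \oc f) (v \oc g).
Proof.
move=> huv hfg i lt_in; apply: eq_bigr => k _; rewrite huv; last first.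
  by apply: leq_ltn_trans lt_in; rewrite -ltnS.
by rewrite !fps_expE (agree_exp _ hfg).
Qed.

Definition contraction (Phi : series R -> series R) :=
  forall n u v, agree n u v -> agree n.+1 (Phi u) (Phi v).

Lemma contraction_unique Phi u v :
  contraction Phi -> Phi u = u -> Phi v = v -> u = v.
Proof.
move=> cPhi Pu Pv; apply: agree_eq; elim=> [|n IH] //.
by rewrite -Pu -Pv; apply: cPhi.
Qed.

(** The iterates of [Phi] from 0 stabilise: coefficient [n] no longer changes from iterate [n + 1]
    on, and the limit is read off there. *)
Lemma contraction_fixpoint Phi : contraction Phi -> exists u, Phi u = u.
Proof.
move=> cPhi; pose s n := iter n Phi 0.
have s_agree n m : (n <= m)%N -> agree n (s n) (s m).
  by elim: n m => [|n IH] [|m] // le_nm; apply: cPhi; apply: IH.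
pose u : series R := fun n => s n.+1 n.
have u_agree n : agree n u (s n).
  by move=> i lt_in; rewrite /u; apply: s_agree.
exists u; apply: agree_eq => n; apply: (@agree_le _ n.+1) => // i lt_in.
by rewrite (u_agree n.+1)//; apply: cPhi.
Qed.

Lemma coefDs u v n : (u + v) n = u n + v n. Proof. by []. Qed.

Lemma coefMs u v n : (u * v) n = \sum_(i < n.+1) u i * v (n - i)%N.
Proof. by []. Qed.

Lemma coef0M u v : (u * v) 0%N = u 0%N * v 0%N.
Proof. by rewrite -[u * v]/(fps_mul u v) /fps_mul big_ord_recl big_ord0 addr0. Qed.

Lemma mulz_coef0 u : ('Z * u) 0%N = 0.
Proof. by rewrite coef0M mul0r. Qed.

Lemma mulz_coefS u n : ('Z * u) n.+1 = u n.
Proof.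
rewrite -['Z * u]/(fps_mul 'Z u) /fps_mul big_ord_recl mul0r add0r big_ord_recl.
rewrite mul1r subSS subn0 big1 ?addr0// => i _.
by rewrite /fps_z mul0r.
Qed.

Lemma mulzE u : 'Z * u = fps_mulz u.
Proof. by apply/funext => -[|n]; rewrite ?mulz_coef0 ?mulz_coefS. Qed.

Lemma divz_mulz u : D ('Z * u) = u.
Proof. by apply/funext => n; apply: mulz_coefS. Qed.

Lemma mulz_divz u : u 0%N = 0 -> 'Z * D u = u.
Proof. by move=> u0; apply/funext => -[|n]; rewrite ?mulz_coef0 ?mulz_coefS. Qed.

Lemma mulz_inj u v : 'Z * u = 'Z * v -> u = v.
Proof. by move=> /(congr1 D); rewrite !divz_mulz. Qed.

Definition fps_const (c : R) : series R := fun n => if n is _.+1 then 0 else c.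

Lemma fps_constM c u n : (fps_const c * u) n = c * u n.
Proof.
rewrite -[fps_const c * u]/(fps_mul (fps_const c) u) /fps_mul big_ord_recl subn0.
by rewrite big1 ?addr0// => i _; rewrite mul0r.
Qed.

(** The Horner step. Since the tail carries a factor [z], it reduces a claim on [u] to a claim on
    [D u] at one degree less of precision. *)
Lemma fps_split u : u = fps_const (u 0%N) + 'Z * D u.
Proof.
apply/funext => -[|n]; rewrite coefDs ?mulz_coef0 ?mulz_coefS.
  by rewrite addr0.
by rewrite add0r.
Qed.

Lemma exp_coef_lt g n k : g 0%N = 0 -> (n < k)%N -> (g ^+ k) n = 0.
Proof.
move=> g0; elim: k n => // k IH n lt_nk; rewrite exprS.
have h : agree k (g ^+ k) 0 by move=> i; apply: IH.
by rewrite (agree_mul_M1 g0 h)// mulr0.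
Qed.

Lemma comp_coef0 f g : (f \oc g) 0%N = f 0%N.
Proof. by rewrite /fps_comp big_ord_recl big_ord0 mulr1 addr0. Qed.

(** Horner's rule for substitution; it replaces the defining sum of [fps_comp] in all later
    arguments. *)
Lemma comp_split f g : g 0%N = 0 ->
  f \oc g = fps_const (f 0%N) + g * (D f \oc g).
Proof.
move=> g0; apply/funext => n; rewrite coefDs /fps_comp.
rewrite big_ord_recl; congr (_ + _).
  by case: n => [|n] /=; rewrite ?mulr1 ?mulr0.
rewrite -[g * _]/(fps_mul g _) /fps_mul.
transitivity (\sum_(i < n.+1) \sum_(k < n) g i * (f k.+1 * (g ^+ k) (n - i)%N)).
  rewrite exchange_big; apply: eq_bigr => k _ /=.
  rewrite -[fps_mul _ _]/(g * fps_exp g k) fps_expE.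
  rewrite -[g * _]/(fps_mul g _) /fps_mul big_distrr.
  by apply: eq_bigr => i _ /=; rewrite mulrCA.
apply: eq_bigr => -[[|i] lt_in] _ /=.
  by rewrite big1 ?g0 ?mul0r// => k _; rewrite mul0r.
(* The inner composition stops at [k <= n - i.+1] while the other sum runs over [k < n]; the extra
   powers of [g] have order too high to contribute. *)
pose G k := g i.+1 * (D f k * fps_exp g k (n - i.+1)%N).
rewrite big_distrr /= (big_ord_widen n G); last first.
  by rewrite ltnS in lt_in; rewrite subnSK ?leq_subr.
rewrite [RHS]big_mkcond; apply: eq_bigr => k _; rewrite /G fps_expE.
by case: ifP => // /negbT; rewrite -leqNgt => /(exp_coef_lt g0) ->; rewrite !mulr0.
Qed.

Lemma compD f1 f2 g : (f1 + f2) \oc g = f1 \oc g + f2 \oc g.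
Proof.
apply/funext => n; rewrite coefDs /fps_comp -big_split.
by apply: eq_bigr => k _; rewrite coefDs mulrDl.
Qed.

Lemma comp_const c g : fps_const c \oc g = fps_const c.
Proof.
apply/funext => n; rewrite /fps_comp big_ord_recl big1 ?addr0.
  by case: n => [|n] /=; rewrite ?mulr1 ?mulr0.
by move=> i _; rewrite mul0r.
Qed.

Lemma comp1s g : 1 \oc g = 1.
Proof.
have ->: 1 = fps_const 1 by apply/funext => -[].
exact: comp_const.
Qed.

Lemma comp_constM c f g : (fps_const c * f) \oc g = fps_const c * (f \oc g).
Proof.
apply/funext => n; rewrite fps_constM /fps_comp big_distrr.
by apply: eq_bigr => k _; rewrite fps_constM /= mulrA.
Qed.

Lemma comp_mulz f g : g 0%N = 0 -> ('Z * f) \oc g = g * (f \oc g).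
Proof.
move=> g0; rewrite comp_split// mulz_coef0 divz_mulz.
by rewrite (_ : fps_const 0 = 0) ?add0r//; apply/funext => -[].
Qed.

(** Splitting off the constant term of [f1] leaves the same identity for [D f1] behind a factor [g],
    so one degree less of precision is enough. *)
Lemma compM f1 f2 g : g 0%N = 0 -> (f1 * f2) \oc g = (f1 \oc g) * (f2 \oc g).
Proof.
move=> g0; apply: agree_eq => n; elim: n f1 => // n IH f1.
rewrite {1}(fps_split f1) mulrDl compD comp_constM -mulrA comp_mulz//.
rewrite (comp_split f1)// mulrDl -mulrA.
by apply: agree_add => //; apply: agree_mul_M1.
Qed.

Lemma compA f g h : g 0%N = 0 -> h 0%N = 0 -> f \oc (g \oc h) = (f \oc g) \oc h.
Proof.
move=> g0 h0; apply: agree_eq => n; elim: n f => // n IH f.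
have gh0 : (g \oc h) 0%N = 0 by rewrite comp_coef0.
rewrite comp_split// (comp_split f g0) compD comp_const compM//.
by apply: agree_add => //; apply: agree_mul_M1.
Qed.

Lemma compzs g : g 0%N = 0 -> 'Z \oc g = g.
Proof. by move=> g0; rewrite -(mulr1 ('Z : series R)) comp_mulz// comp1s mulr1. Qed.

Lemma compsz f : f \oc 'Z = f.
Proof.
apply: agree_eq => n; elim: n f => // n IH f.
rewrite comp_split// [X in agree _ _ X]fps_split.
by apply: agree_add => //; apply: agree_mul_M1.
Qed.

(** The inverse is the fixed point of [v = 1 + (1 - u) v], a contraction because [1 - u] has no
    constant term. *)
Lemma inv_exists u : u 0%N = 1 -> exists v, u * v = 1.
Proof.
move=> u0; pose Phi v := 1 + (1 - u) * v.
have w0 : (1 - u) 0%N = 0 by rewrite -[LHS]/(1 - u 0%N) u0 subrr.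
have [n a b h|v Pv] := @contraction_fixpoint Phi.
  by apply: agree_add => //; apply: agree_mul_M1.
exists v; move: Pv; rewrite /Phi mulrBl mul1r addrCA -[X in _ = X]addr0.
by move=> /addrI/eqP; rewrite subr_eq0 => /eqP.
Qed.

(** With [v] the inverse of [f/z], solve the contraction [g = z v(g)]; then
    [f(g) = g (f/z)(g) = z v(g) (f/z)(g) = z]. *)
Lemma comp_rinv_exists f : f 0%N = 0 -> f 1%N = 1 ->
  exists g, [/\ g 0%N = 0, g 1%N = 1 & f \oc g = 'Z].
Proof.
move=> f0 f1; have [v Dv] := @inv_exists (D f) f1.
have v0 : v 0%N = 1.
  by have := congr1 (@^~ 0%N) Dv; rewrite coef0M -[D f 0%N]/(f 1%N) f1 mul1r.
have [n a b h|g Pg] := @contraction_fixpoint (fun g => 'Z * (v \oc g)).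
  by apply: agree_mul_M1 => //; apply: agree_comp.
have g0 : g 0%N = 0 by rewrite -Pg mulz_coef0.
exists g; split=> //; first by rewrite -Pg mulz_coefS comp_coef0.
rewrite -(mulz_divz f0) comp_mulz// -{1}Pg -mulrA -compM// mulrC.
by rewrite mulrC (mulrC v) Dv comp1s mulr1.
Qed.

End SeriesTheory.

(** * Non-crossing partitions as binary trees *)

Inductive bintree := Leaf | Node of bintree & bintree.

Lemma bintree_comparable : comparable bintree.
Proof. by move=> t u; rewrite /decidable; decide equality. Qed.

HB.instance Definition _ := hasDecEq.Build bintree (compareP bintree_comparable).

Section Trees.
Local Open Scope nat_scope.

Fixpoint tree_size t := if t is Node l r then (tree_size l + tree_size r).+1 else 0.

(* The partition coded by [Node l r]: l lives on ]0, j[ and r on [j, n[, where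
   j = tree_size l + 1, and 0 joins the block of j.  [tmin t x] is the least
   element of the block of x, [tkmax t x] the largest element of its Kreweras
   block. *)
Fixpoint tmin t x :=
  if t is Node l r then
    if 0 < x <= tree_size l then (tmin l x.-1).+1 else
    let y := tmin r (x - (tree_size l).+1) in
    if y == 0 then 0 else y + (tree_size l).+1
  else x.

Fixpoint tkmax t x :=
  if t is Node l r then
    if x is y.+1 then
      if y < tree_size l then (tkmax l y).+1 else tkmax r (y - tree_size l) + (tree_size l).+1
    else tree_size l
  else x.

Lemma tmin0 t : tmin t 0 = 0.
Proof. by elim: t => //= l _ r ->. Qed.

Lemma tmin_l l r x : x < tree_size l -> tmin (Node l r) x.+1 = (tmin l x).+1.
Proof. by move=> /= ->. Qed.

Lemma tmin_r l r x : tmin (Node l r) (x + (tree_size l).+1) =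
  if tmin r x == 0 then 0 else tmin r x + (tree_size l).+1.
Proof. by rewrite /= addnK ifN//; lia. Qed.

(** The three kinds of positions in [Node l r]: the root, a position of [l] shifted by 1, a position
    of [r] shifted by [tree_size l + 1]. *)
Variant node_spec l : nat -> Type :=
  | NodeZero : node_spec l 0
  | NodeLeft x of x < tree_size l : node_spec l x.+1
  | NodeRight x : node_spec l (x + (tree_size l).+1).

Lemma nodeP l x : node_spec l x.
Proof.
case: x => [|x]; first exact: NodeZero.
have [lt_x|ge_x] := ltnP x (tree_size l); first exact: NodeLeft.
by rewrite -(subnK ge_x) -addnS; apply: NodeRight.
Qed.

Lemma tmin_le t x : tmin t x <= x.
Proof.
elim: t x => // l IHl r IHr x; case: (nodeP l x) => [|y lt_y|y].
- by rewrite tmin0.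
- by rewrite tmin_l// ltnS.
- by rewrite tmin_r; case: ifP => // _; rewrite leq_add2r.
Qed.

Lemma tmin_idem t x : tmin t (tmin t x) = tmin t x.
Proof.
elim: t x => // l IHl r IHr x; case: (nodeP l x) => [|y lt_y|y].
- by rewrite !tmin0.
- by rewrite !tmin_l ?IHl//; apply: leq_ltn_trans lt_y; apply: tmin_le.
- rewrite tmin_r; case: ifP => [|tN0]; first by rewrite tmin0.
  by rewrite tmin_r IHr tN0.
Qed.

Lemma tkmax_l l r x : x < tree_size l -> tkmax (Node l r) x.+1 = (tkmax l x).+1.
Proof. by move=> /= ->. Qed.

Lemma tkmax_r l r x :
  tkmax (Node l r) (x + (tree_size l).+1) = tkmax r x + (tree_size l).+1.
Proof. by rewrite addnS /= ltnNge leq_addl addnK. Qed.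

Lemma tkmax_ge t x : x <= tkmax t x.
Proof.
elim: t x => // l IHl r IHr x; case: (nodeP l x) => [|y lt_y|y] //.
- by rewrite tkmax_l// ltnS.
- by rewrite tkmax_r leq_add2r.
Qed.

Lemma tkmax_lt t x : x < tree_size t -> tkmax t x < tree_size t.
Proof.
elim: t x => // l IHl r IHr x; case: (nodeP l x) => [|y lt_y|y] lt_x.
- by rewrite /= ltnS leq_addr.
- by have := IHl _ lt_y; rewrite tkmax_l//=; lia.
- by rewrite tkmax_r; have := IHr y; move: lt_x => /=; lia.
Qed.

Lemma tkmax_last t : tkmax t (tree_size t).-1 = (tree_size t).-1.
Proof.
case: t => // l r; apply/eqP; rewrite eqn_leq tkmax_ge andbT.
by rewrite -ltnS prednK//; apply: tkmax_lt.
Qed.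

Lemma tkmax_idem t x : tkmax t (tkmax t x) = tkmax t x.
Proof.
elim: t x => // l IHl r IHr x; case: (nodeP l x) => [|y lt_y|y].
- rewrite /= -[in RHS](addn0 (tree_size l)); case E: (tree_size l) => [|s] //=.
  by rewrite ltnSn -[s]/(s.+1.-1) -E tkmax_last E addn0.
- by rewrite !tkmax_l ?IHl// tkmax_lt.
- by rewrite !tkmax_r IHr.
Qed.

(** Positions in [l] share labels only among themselves. Elsewhere labels are compared in [r], where
    truncated subtraction sends both 0 and [j] to 0: this is how 0 joins the block of [j]. *)
Lemma tmin_eq l r x y (N := Node l r) (inl := fun z => 0 < z <= tree_size l)
    (j := (tree_size l).+1) :
  (tmin N x == tmin N y) =
    if inl x then inl y && (tmin l x.-1 == tmin l y.-1)
    else ~~ inl y && (tmin r (x - j) == tmin r (y - j)).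
Proof.
rewrite /inl /j /=; have := tmin_le l x.-1; have := tmin_le l y.-1.
have [lx|lx] := boolP (0 < x <= tree_size l); have [ly|ly] := boolP (0 < y <= tree_size l);
  rewrite /= ?eqSS// => hy hx.
- by case: ifP => _; lia.
- by case: ifP => _; lia.
- case: (eqVneq (tmin r (x - _)) 0) => [xE|xN0];
    case: (eqVneq (tmin r (y - _)) 0) => [yE|yN0]; rewrite ?eqn_add2r//; lia.
Qed.

Lemma tmin_noncrossing t a b c d : a < b < c -> c < d ->
  tmin t a == tmin t c -> tmin t b == tmin t d -> tmin t a == tmin t b.
Proof.
elim: t a b c d => [|l IHl r IHr] a b c d; first by move=> /=; lia.
rewrite !tmin_eq => abc cd.
have [la|la] := boolP (0 < a <= tree_size l); have [lb|lb] := boolP (0 < b <= tree_size l).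
- by move=> /andP[lc eq_ac] /andP[ld eq_bd]; apply: IHl eq_ac eq_bd; lia.
- by move=> /andP[lc _]; lia.
- by move=> /andP[lc _] /andP[ld _]; lia.
move=> /andP[lc eq_ac] /andP[ld eq_bd] /=.
(* Equal coordinates in [r] occur for [a = 0] and [b = j], which lie in one block; otherwise the
   order is strict and the induction hypothesis applies. *)
have [->//|ltab] := eqVneq (a - (tree_size l).+1) (b - (tree_size l).+1).
by apply: IHr eq_ac eq_bd; lia.
Qed.

(* i and k lie in the same Kreweras block iff ]i, k] is a union of blocks. *)
Lemma tkmaxP t i k : i <= k -> k < tree_size t ->
  tkmax t i = tkmax t k <->
  (forall x, x < tree_size t -> (i < x <= k) = (i < tmin t x <= k)).
Proof.
elim: t i k => // l IHl r IHr i k.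
rewrite [tree_size (Node _ _)]/=.
case: (nodeP l i) => [|i' lt_i|i']; case: (nodeP l k) => [|k' lt_k|k'] le_ik lt_kn.
- by split=> // _ x _; rewrite !leqn0; lia.
- rewrite tkmax_l// -[tkmax _ 0]/(tree_size l).
  (* Position 0 has the Kreweras block of the last element of [l]. In the coordinates of [l], []0,
     k'+1]] is [[0, k']], the complement of []k', last]], so the hypothesis is applied to the pair
     [k'], [last]. *)
  have last_l := tkmax_last l.
  have le_k : k' <= (tree_size l).-1 by lia.
  have lt_l : (tree_size l).-1 < tree_size l by lia.
  have [satP Psat] := IHl _ _ le_k lt_l; split=> [eq_k x lt_x|sat].
    case: (nodeP l x) => [|x' lt_x'|x']; first by rewrite tmin0.
      have := satP _ x' lt_x'; have := tmin_le l x'; rewrite tmin_l//; lia.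
    by rewrite tmin_r; case: eqP; lia.
  have: tkmax l k' = tkmax l (tree_size l).-1; last lia.
  apply: Psat => x lt_x; have := sat x.+1; rewrite tmin_l//=.
  by have := tmin_le l x; lia.
- split; first by rewrite tkmax_r -[tkmax _ 0]/(tree_size l); lia.
  (* The interval contains position [tree_size l + 1] but not 0, which lies in the same block. *)
  by move/(_ (tree_size l).+1); rewrite -[X in tmin _ X]add0n tmin_r tmin0 /=; lia.
- lia.
- rewrite !tkmax_l//; have [satP Psat] := IHl i' k' le_ik lt_k.
  split=> [[/satP eq_k] x lt_x|sat].
    case: (nodeP l x) => [|x' lt_x'|x']; first by rewrite tmin0.
      by have := eq_k x' lt_x'; rewrite tmin_l//; lia.
    by rewrite tmin_r; case: eqP; lia.
  congr _.+1; apply: Psat => x lt_x; have := sat x.+1; rewrite tmin_l//=.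
  by lia.
- have := tkmax_lt lt_i; rewrite tkmax_l// tkmax_r; split; first lia.
  by move/(_ (tree_size l).+1); rewrite -[X in tmin _ X]add0n tmin_r tmin0 /=; lia.
- lia.
- lia.
- have lt_k : k' < tree_size r by move: lt_kn => /=; lia.
  have [/=|satP Psat] := IHr i' k' _ lt_k; first lia.
  rewrite !tkmax_r; split=> [eq_k x lt_x|sat].
    case: (nodeP l x) lt_x => [|x' lt_x'|x'] lt_x; first by rewrite tmin0.
      by rewrite tmin_l//; have := tmin_le l x'; lia.
    have := satP _ x'; move: lt_x; rewrite tmin_r /=.
    by have := tmin0 r; case: eqP => [|_]; lia.
  congr (_ + _); apply: Psat => x lt_x; have := sat (x + (tree_size l).+1).
  by rewrite tmin_r /=; case: eqP => [|_]; lia.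
Qed.

(** Cut at the least positive [j = s + 1] labelled like 0. By the non-crossing condition no label is
    common to []0, j[] and [[j, n[], so trees for the two restrictions can be joined by a [Node]. *)
Lemma tree_of_label (T : eqType) n (c : nat -> T) :
    (forall x y z w, x < y < z -> z < w < n ->
       c x == c z -> c y == c w -> c x == c y) ->
  exists2 t, tree_size t = n & forall x y, x < n -> y < n ->
    (tmin t x == tmin t y) = (c x == c y).
Proof.
elim/ltn_ind: n c => -[|n] IH c ncc; first by exists Leaf.
(* The position [n.+1] past the end stands for a block of 0 without other elements; the right
   subtree is then empty. *)
have exP : exists j, (0 < j) && ((j == n.+1) || (c j == c 0)).
  by exists n.+1; rewrite eqxx.
case: (ex_minnP exP) => -[//|s] /= Ps min_s.
have le_sn : s <= n by have := min_s n.+1; rewrite eqxx; apply.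
have c_s : s < n -> c s.+1 = c 0.
  by move=> lt_s; apply/eqP; case/orP: Ps => //; lia.
have c_l x : 0 < x <= s -> (c x == c 0) = false.
  by case/andP=> x0 le_xs; apply: contraTF le_xs => cx; rewrite -ltnNge min_s// x0 cx orbT.
have c_lr x y : 0 < x <= s -> s < y <= n -> (c x == c y) = false.
  move=> hx hy; have [->|neq_y] := eqVneq y s.+1.
    by rewrite c_s ?c_l//; lia.
  (* A common label of [x] and [y] would make their pair cross the pair [0], [s + 1]. *)
  apply: contraFF (c_l x hx) => cxy; rewrite eq_sym.
  by apply: (ncc 0 x s.+1 y) cxy; rewrite ?c_s//; lia.
have [|x y z w hxy hzw|l sz_l El] := IH s _ (fun x => c x.+1); first by lia.
  by apply: ncc; lia.
have [|x y z w hxy hzw|r sz_r Er] := IH (n - s) _ (fun x => c (x + s.+1)); first by lia.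
  by apply: ncc; lia.
(* Going to the coordinates of [r] and back moves 0 to [s + 1], which has the same label. *)
have c_r x : ~~ (0 < x <= s) -> x <= n -> s < n -> c (x - s.+1 + s.+1) = c x.
  move=> hx le_xn lt_sn; case: (posnP x) => [->|x0]; first by rewrite sub0n add0n c_s.
  by congr c; lia.
exists (Node l r) => [|x y lt_x lt_y]; first by rewrite /= sz_l sz_r; lia.
rewrite tmin_eq sz_l.
have [hx|hx] := boolP (0 < x <= s); have [hy|hy] /= := boolP (0 < y <= s).
- by rewrite El ?prednK//; lia.
- by case: (posnP y) => [->|y0]; rewrite ?c_l// c_lr//; lia.
- by rewrite eq_sym; case: (posnP x) => [->|x0]; rewrite ?c_l// c_lr//; lia.
case: (ltnP s n) => [lt_sn|ge_sn]; first by rewrite Er ?c_r//; lia.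
have -> : x = 0 by lia.
have -> : y = 0 by lia.
by rewrite !eqxx.
Qed.

(** The size of the left subtree is determined by the labels, as [tree_size l + 1] is the first
    position that joins the block of 0; the two subtrees are then recovered by restriction. *)
Lemma tmin_inj t u : tree_size t = tree_size u ->
    (forall x y, x < tree_size t -> y < tree_size t ->
       (tmin t x == tmin t y) = (tmin u x == tmin u y)) ->
  t = u.
Proof.
elim: t u => [|l IHl r IHr] [|l' r'] // sz_tu eq_tu.
have sz_l : tree_size l = tree_size l'.
  wlog lt_l : l l' r r' sz_tu eq_tu {IHl IHr} / tree_size l < tree_size l'.
    move=> W; have [||//] := ltngtP (tree_size l) (tree_size l').
      exact: W sz_tu eq_tu.
    move=> lt_l; apply/esym; apply: (W _ _ r' r) => // x y lt_x lt_y.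
    by rewrite eq_tu// sz_tu.
  have := eq_tu 0 (tree_size l).+1; move: sz_tu; rewrite !tmin_eq /= subnn lt_l eqxx; lia.
have sz_r : tree_size r = tree_size r' by move: sz_tu => /=; lia.
congr Node; [apply: IHl => // x y lt_x lt_y|apply: IHr => // x y lt_x lt_y].
  have := eq_tu x.+1 y.+1; rewrite !tmin_eq /= -sz_l lt_x lt_y /=; apply; lia.
pose sh x := if x == 0 then 0 else x + (tree_size l).+1.
have shK z : (0 < sh z <= tree_size l) = false /\ sh z - (tree_size l).+1 = z.
  by rewrite /sh; case: eqP => [->|_]; [|split]; lia.
have [s1 s2] := shK x; have [s3 s4] := shK y.
have := eq_tu (sh x) (sh y); rewrite !tmin_eq -sz_l s1 s2 s3 s4 /=.
by rewrite /sh; apply; case: eqP; lia.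
Qed.

(** An enumeration by height, so that a sum over nodes is a double sum. A tree with at most [d]
    nodes has height at most [d], hence [trees d n] is complete for [n <= d]. *)
Fixpoint trees_upto d :=
  if d is e.+1 then
    Leaf :: [seq Node l r | l <- trees_upto e, r <- trees_upto e]
  else [:: Leaf].

Definition trees d n := [seq t <- trees_upto d | tree_size t == n].

Lemma trees_upto_uniq d : uniq (trees_upto d).
Proof.
elim: d => //= d IH; apply/andP; split; first by apply/allpairsP => -[p []].
by apply: allpairs_uniq => // -[l r] [l' r'] _ _ [-> ->].
Qed.

Lemma mem_trees_upto d t : tree_size t <= d -> t \in trees_upto d.
Proof.
elim: d t => [|d IH] [|l r] le_d //; try exact: mem_head.
rewrite in_cons; apply/predU1P; right.
by apply: allpairs_f; apply: IH; move: le_d => /=; lia.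
Qed.

Lemma mem_trees d n t : n <= d -> (t \in trees d n) = (tree_size t == n).
Proof.
move=> le_nd; rewrite mem_filter; case: eqP => //= eq_t.
by apply: mem_trees_upto; rewrite eq_t.
Qed.

Lemma trees_uniq d n : uniq (trees d n).
Proof. exact/filter_uniq/trees_upto_uniq. Qed.

Lemma trees_perm d n : n <= d -> perm_eq (trees d n) (trees n n).
Proof.
move=> le_nd; apply: uniq_perm; rewrite ?trees_uniq// => t.
by rewrite !mem_trees.
Qed.

End Trees.

(** * Partitions given by a labelling *)

Section LabelPartition.
Variables (n : nat) (T : eqType).
Implicit Types (c : 'I_n -> T) (P Q : {set {set 'I_n}}).

Definition label_part c := preim_partition c [set: 'I_n].

Lemma mem_label_part c (A : {set 'I_n}) :
  reflect (exists x, A = [set y | c x == c y]) (A \in label_part c).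
Proof.
apply: (iffP imsetP) => -[x]; first by move=> _ ->; exists x; apply/setP => y; rewrite !inE.
by move=> ->; exists x => //; apply/setP => y; rewrite !inE.
Qed.

Lemma label_part_partition c : partition (label_part c) [set: 'I_n].
Proof. exact: preim_partitionP. Qed.

Lemma label_part_inj (T' : eqType) c (c' : 'I_n -> T') :
  label_part c = preim_partition c' [set: 'I_n] -> forall x y, (c x == c y) = (c' x == c' y).
Proof.
move=> eq_P x y.
have : [set z | c x == c z] \in label_part c by apply/mem_label_part; exists x.
rewrite eq_P => /imsetP[x' _ /setP h].
have := h x; have := h y; rewrite !inE eqxx => -> /esym/eqP ->.
by [].
Qed.

End LabelPartition.

Lemma eq_label_part n (T T' : eqType) (c : 'I_n -> T) (c' : 'I_n -> T') :
  (forall x y, (c x == c y) = (c' x == c' y)) -> label_part c = label_part c'.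
Proof.
move=> eq_c; apply/setP => A; apply/mem_label_part/mem_label_part => -[x ->]; exists x;
  by apply/setP => y; rewrite !inE eq_c.
Qed.

(** Refining twice puts a block [A] inside some [B] and [B] inside a block [C] of the first
    partition; disjointness forces [A = C], hence [A = B]. *)
Lemma refines_anti (T : finType) (P Q : {set {set T}}) :
  partition P [set: T] -> partition Q [set: T] ->
  refines P Q -> refines Q P -> P = Q.
Proof.
suff W (P' Q' : {set {set T}}) : partition P' [set: T] -> partition Q' [set: T] ->
  refines P' Q' -> refines Q' P' -> P' \subset Q'.
  by move=> ? ? ? ?; apply/eqP; rewrite eqEsubset !W.
move=> /and3P[_ /trivIsetP tP nP] _ /forall_inP rPQ /forall_inP rQP.
apply/subsetP => A PA; have /exists_inP[B QB sAB] := rPQ _ PA.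
have /exists_inP[C PC sBC] := rQP _ QB.
have AC : A = C.
  apply/eqP/contraT => /(tP _ _ PA PC); rewrite -setI_eq0 (setIidPl _) => [/eqP A0|].
    by rewrite -A0 PA in nP.
  exact: subset_trans sBC.
by rewrite (_ : A = B)//; apply/eqP; rewrite eqEsubset sAB AC.
Qed.

(** * The non-crossing partition of a tree and its Kreweras complement *)

Section TreePartition.
Variable n : nat.

Definition tree_part t : {set {set 'I_n}} := label_part (fun i : 'I_n => tmin t i).
Definition tree_kpart t : {set {set 'I_n}} := label_part (fun i : 'I_n => tkmax t i).

Lemma tree_part_NC t : tree_part t \in NC n.
Proof.
rewrite inE /nc_partition label_part_partition /=.
apply/forall_inP => A /mem_label_part[x ->]; apply/forall_inP => B /mem_label_part[y ->].
apply/forall_inP => a; rewrite inE => /eqP xa; apply/forall_inP => c; rewrite inE => /eqP xc.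
apply/forall_inP => b; rewrite inE => /eqP yb; apply/forall_inP => d; rewrite inE => /eqP yd.
apply/implyP => /and3P[ab bc cd]; apply/eqP/setP => z; rewrite !inE xa yb.
have abc : (a < b < c)%N by rewrite ab.
by rewrite (eqP (tmin_noncrossing abc cd (t := t) _ _))// -?xa -?yb ?xc ?yd.
Qed.

(** Each element is labelled by its own block, and [tree_of_label] supplies the tree. *)
Lemma NC_tree_part P : P \in NC n -> exists2 t, tree_size t = n & P = tree_part t.
Proof.
rewrite inE => /andP[partP /forall_inP ncP].
have [/eqP covP trivP _] := and3P partP.
have covx (i : 'I_n) : i \in cover P by rewrite covP inE.
pose c x : {set 'I_n} := if insub x is Some i then pblock P i else set0.
have cE (i : 'I_n) : c i = pblock P i by rewrite /c valK.
have [x y z w xyz zw|t sz_t Et] := @tree_of_label _ n c.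
  have [zn wn] : (z < n)%N /\ (w < n)%N by lia.
  have [xn yn] : (x < n)%N /\ (y < n)%N by lia.
  have := cE (Ordinal xn); have := cE (Ordinal yn); have := cE (Ordinal zn).
  have := cE (Ordinal wn) => /= -> -> -> -> /eqP exz /eqP eyw.
  have /forall_inP := ncP _ (pblock_mem (covx (Ordinal xn))).
  move/(_ _ (pblock_mem (covx (Ordinal yn)))).
  move=> /forall_inP/(_ (Ordinal xn)); rewrite mem_pblock => /(_ (covx _)).
  move=> /forall_inP/(_ (Ordinal zn)); rewrite exz mem_pblock => /(_ (covx _)).
  move=> /forall_inP/(_ (Ordinal yn)); rewrite mem_pblock => /(_ (covx _)).
  move=> /forall_inP/(_ (Ordinal wn)); rewrite eyw mem_pblock => /(_ (covx _)).
  by move/implyP; apply; rewrite /=; lia.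
exists t => //; rewrite -(preim_partition_pblock partP).
by apply: eq_label_part => x y; rewrite -!cE Et.
Qed.

Variable t : bintree.
Hypothesis size_t : tree_size t = n.

(** [tkmaxP] compares an element with the minimum of its block; here two arbitrary elements of a
    block are compared through that minimum. *)
Lemma tkmax_eqP (i k : 'I_n) : (i <= k)%N -> reflect
  (forall x y : 'I_n, tmin t x == tmin t y -> (i < x <= k)%N -> (i < y <= k)%N)
  (tkmax t i == tkmax t k).
Proof.
move=> le_ik; have lt_k : (k < tree_size t)%N by rewrite size_t.
have [satP Psat] := tkmaxP le_ik lt_k.
apply: (iffP eqP) => [/satP sat x y /eqP eq_xy|sat].
  by rewrite sat ?size_t// (sat y) ?size_t// eq_xy.
apply: Psat => x; rewrite size_t => lt_x.
have lt_m : (tmin t x < n)%N by apply: leq_ltn_trans lt_x; apply: tmin_le.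
have eq_m : tmin t x == tmin t (tmin t x) by rewrite tmin_idem.
apply/idP/idP => [h|h]; first exact: (sat (Ordinal lt_x) (Ordinal lt_m)).
by apply: (sat (Ordinal lt_m) (Ordinal lt_x)) h; rewrite eq_sym.
Qed.

(** []a, b]] is []a, c]] minus []b, d]], a difference of two unions of blocks. *)
Lemma tkmax_noncrossing (a b c d : 'I_n) : (a < b < c)%N -> (c < d)%N ->
  tkmax t a == tkmax t c -> tkmax t b == tkmax t d -> tkmax t a == tkmax t b.
Proof.
move=> abc cd ac bd.
have le_ac : (a <= c)%N by lia.
have le_bd : (b <= d)%N by lia.
have le_ab : (a <= b)%N by lia.
move: ac bd => /(tkmax_eqP le_ac) ac /(tkmax_eqP le_bd) bd.
apply/(tkmax_eqP le_ab) => x y xy hx.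
have := ac x y xy; have := bd y x; rewrite eq_sym xy => /(_ isT); lia.
Qed.

Lemma tree_kpart_NC : tree_kpart t \in NC n.
Proof.
rewrite inE /nc_partition label_part_partition /=.
apply/forall_inP => A /mem_label_part[x ->]; apply/forall_inP => B /mem_label_part[y ->].
apply/forall_inP => a; rewrite inE => /eqP xa; apply/forall_inP => c; rewrite inE => /eqP xc.
apply/forall_inP => b; rewrite inE => /eqP yb; apply/forall_inP => d; rewrite inE => /eqP yd.
apply/implyP => /and3P[ab bc cd]; apply/eqP/setP => z; rewrite !inE xa yb.
have abc : (a < b < c)%N by rewrite ab.
by rewrite (eqP (tkmax_noncrossing abc cd _ _))// -?xa -?yb ?xc ?yd.
Qed.

Let lab (x : 'I_n + 'I_n) : nat + nat :=
  match x with inl i => inl (tmin t i) | inr i => inr (tkmax t i) end.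

Lemma interleave_tree :
  interleave (tree_part t) (tree_kpart t) = preim_partition lab setT.
Proof.
have imgl i : [set y in setT | lab (inl i) == lab y] =
    inl @: [set y : 'I_n | tmin t i == tmin t y].
  apply/setP => -[y|y]; rewrite !inE /= ?mem_imset ?inE//; try exact: inl_inj.
  by apply/esym/imsetP => -[].
have imgr i : [set y in setT | lab (inr i) == lab y] =
    inr @: [set y : 'I_n | tkmax t i == tkmax t y].
  apply/setP => -[y|y]; rewrite !inE /= ?mem_imset ?inE//; try exact: inr_inj.
  by apply/esym/imsetP => -[].
apply/setP => A; rewrite inE; apply/orP/imsetP.
  case=> /imsetP[B /mem_label_part[x ->] ->]; first by exists (inl x).
  by exists (inr x).
case=> -[x|x] _ ->; [left|right]; rewrite ?imgl ?imgr; apply: imset_f;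
  by apply/mem_label_part; exists x.
Qed.

Lemma kreweras_compatible_tree : kreweras_compatible (tree_part t) (tree_kpart t).
Proof.
rewrite /kreweras_compatible tree_kpart_NC interleave_tree /nc_partition.
rewrite preim_partitionP /=.
apply/forall_inP => A /imsetP[x _ ->]; apply/forall_inP => B /imsetP[y _ ->].
apply/forall_inP => a; rewrite !inE => /eqP xa; apply/forall_inP => c; rewrite !inE => /eqP xc.
apply/forall_inP => b; rewrite !inE => /eqP yb; apply/forall_inP => d; rewrite !inE => /eqP yd.
apply/implyP => /and3P[ab bc cd]; apply/eqP/setP => z; rewrite !inE xa yb.
suff -> : lab a = lab b by [].
have {xa xc}: lab a = lab c by rewrite -xa -xc.
have {yb yd}: lab b = lab d by rewrite -yb -yd.
(* Equal labels force [a], [c] to be of one kind and [b], [d] of one kind. If the kinds differ, the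
   barred pair bounds an interval containing just one element of the other pair, against
   [tkmax_eqP]. *)
move: a b c d ab bc cd => [a|a] [b|b] [c|c] [d|d] //= ab bc cd [eq_bd] [eq_ac].
- congr inl; apply/eqP; apply: (@tmin_noncrossing t a b c d); rewrite ?eq_bd ?eq_ac//; lia.
- have le_bd : (b <= d)%N by lia.
  have /(tkmax_eqP le_bd)/(_ c a) : tkmax t b == tkmax t d by rewrite eq_bd.
  by rewrite eq_ac eqxx => /(_ isT); lia.
- have le_ac : (a <= c)%N by lia.
  have /(tkmax_eqP le_ac)/(_ b d) : tkmax t a == tkmax t c by rewrite eq_ac.
  by rewrite eq_bd eqxx => /(_ isT); lia.
- congr inr; apply/eqP; apply: (@tkmax_noncrossing a b c d); rewrite ?eq_bd ?eq_ac//; lia.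
Qed.

(** If [j] and [k] lie in one block of [Q], a block of the tree partition meeting both []j, k]] and
    its complement would cross that block in the doubled set; so [tkmax_eqP] applies. *)
Lemma kreweras_compatible_refines Q :
  kreweras_compatible (tree_part t) Q -> refines Q (tree_kpart t).
Proof.
case/andP; rewrite inE => /andP[/and3P[_ _ Q0] _] /andP[_ /forall_inP nc].
apply/forall_inP => B QB.
have [i Bi] : exists i, i \in B by apply/set0Pn; apply: contraNneq Q0 => <-.
apply/exists_inP; exists [set y : 'I_n | tkmax t i == tkmax t y].
  by apply/mem_label_part; exists i.
have cross (j k x y : 'I_n) : j \in B -> k \in B -> tmin t x == tmin t y ->
    (j < x <= k)%N -> (j < y <= k)%N.
  move=> Bj Bk xy hx; apply/negPn/negP => hy.
  pose A := [set z : 'I_n | tmin t x == tmin t z].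
  have PA : inl @: A \in interleave (tree_part t) Q.
    by rewrite inE imset_f//; apply/mem_label_part; exists x.
  have PB : inr @: B \in interleave (tree_part t) Q by rewrite inE imset_f ?orbT.
  have Ax : inl x \in (inl @: A : {set 'I_n + 'I_n}) by apply: imset_f; rewrite inE.
  have Ay : inl y \in (inl @: A : {set 'I_n + 'I_n}) by apply: imset_f; rewrite inE.
  have Bj' : inr j \in (inr @: B : {set 'I_n + 'I_n}) by apply: imset_f.
  have Bk' : inr k \in (inr @: B : {set 'I_n + 'I_n}) by apply: imset_f.
  have neqAB : (inl @: A : {set 'I_n + 'I_n}) <> inr @: B.
    by move=> eqAB; move: Ax; rewrite eqAB => /imsetP[].
  (* The crossing is [y], bar [j], [x], bar [k] if [y <= j], and bar [j], [x], bar [k], [y] if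
     [y > k]. *)
  have [le_yj|lt_jy] := leqP y j.
    move: (nc _ PA) => /forall_inP/(_ _ PB)/forall_inP/(_ _ Ay)/forall_inP/(_ _ Ax).
    move=> /forall_inP/(_ _ Bj')/forall_inP/(_ _ Bk')/implyP h; apply/neqAB/eqP/h.
    by rewrite /= !ltnS !leq_double ltn_Sdouble le_yj.
  move: (nc _ PB) => /forall_inP/(_ _ PA)/forall_inP/(_ _ Bj')/forall_inP/(_ _ Bk').
  move=> /forall_inP/(_ _ Ax)/forall_inP/(_ _ Ay)/implyP h; apply/neqAB/esym/eqP/h.
  rewrite /= ltnS leq_double !ltn_Sdouble; case/andP: hx => -> -> /=.
  by move: hy; rewrite lt_jy -ltnNge.
apply/subsetP => k Bk; rewrite inE.
wlog le_ik : i k Bi Bk / (i <= k)%N.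
  move=> W; case/orP: (leq_total i k) => le_ik; first exact: W.
  by rewrite eq_sym W.
by apply/tkmax_eqP => // x y; apply: cross.
Qed.

(** [tree_kpart t] is compatible and greatest, so the search succeeds; by antisymmetry of refinement
    whatever it returns equals [tree_kpart t]. *)
Lemma kreweras_tree : kreweras (tree_part t) = tree_kpart t.
Proof.
rewrite /kreweras; case: pickP => [Q /andP[compQ /forallP maxQ] /=|/(_ (tree_kpart t))].
  have partQ : partition Q [set: 'I_n].
    by move: compQ => /andP[]; rewrite inE => /andP[].
  apply: refines_anti => //; first exact: label_part_partition.
    exact: kreweras_compatible_refines.
  exact: (implyP (maxQ _) kreweras_compatible_tree).
rewrite kreweras_compatible_tree /= => /negbT/forallPn[Q].
by rewrite negb_imply => /andP[/kreweras_compatible_refines ->].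
Qed.

End TreePartition.

(** * Weighted sums over trees *)

Definition class_size (c : nat -> nat) (i n : nat) : nat :=
  count (fun x => c x == i) (iota 0 n).

Lemma class_size_node c i s1 s2 : class_size c i (s1 + s2).+1 =
  ((c 0 == i) + (count (fun x => c x.+1 == i) (iota 0 s1)
   + count (fun x => c (x + s1.+1) == i) (iota 0 s2)))%N.
Proof.
rewrite /class_size /= iotaD count_cat -[1%N]addn0 iotaDl count_map.
rewrite -[(1 + 0 + s1)%N]addn0 iotaDl count_map; congr (_ + (_ + _))%N.
by apply: eq_count => x /=; rewrite addnC addn0 add1n.
Qed.

Lemma count_iota0 (p : pred nat) n :
  (forall x, (x < n)%N -> p x = false) -> count p (iota 0 n) = 0%N.
Proof.
move=> h; rewrite (eq_in_count (a2 := pred0)) ?count_pred0// => x.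
by rewrite mem_iota => /h.
Qed.

Lemma eq_count_iota (p q : pred nat) n :
  (forall x, (x < n)%N -> p x = q x) -> count p (iota 0 n) = count q (iota 0 n).
Proof. by move=> h; apply: eq_in_count => x; rewrite mem_iota => /h. Qed.

Lemma class_size_tmin0 l r : 
  class_size (tmin (Node l r)) 0 (tree_size l + tree_size r).+1 =
    (class_size (tmin r) 0 (tree_size r)).+1.
Proof.
rewrite class_size_node tmin0 eqxx add1n count_iota0 => [|x lt_x].
  congr _.+1; apply: eq_count_iota => x _; rewrite tmin_r.
  by case: (tmin r x).
by rewrite tmin_l.
Qed.

Lemma class_size_tmin_l l r i : (i < tree_size l)%N -> 
  class_size (tmin (Node l r)) i.+1 (tree_size l + tree_size r).+1 =
    class_size (tmin l) i (tree_size l).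
Proof.
move=> lt_i; rewrite class_size_node tmin0 add0n [X in (_ + X)%N]count_iota0.
  by rewrite addn0; apply: eq_count_iota => x lt_x; rewrite tmin_l.
by move=> x _; rewrite tmin_r; case: ifP; lia.
Qed.

Lemma class_size_tmin_r l r i : (0 < i)%N -> 
  class_size (tmin (Node l r)) (i + (tree_size l).+1) (tree_size l + tree_size r).+1 =
    class_size (tmin r) i (tree_size r).
Proof.
move=> i0; rewrite class_size_node tmin0 count_iota0 => [|x lt_x].
  rewrite (_ : (0 == _)%N = false) ?add0n; last by lia.
  apply: eq_count_iota => x _; rewrite tmin_r.
  by case: (eqVneq (tmin r x) 0%N) => [->|_]; rewrite ?eqn_add2r//; lia.
by rewrite tmin_l//; have := tmin_le l x; lia.
Qed.

(** Position 0 enters the Kreweras block of the last element of [l]. For empty [l] that class is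
    empty and 0 is alone. *)
Lemma class_size_tkmax_last l r : 
  class_size (tkmax (Node l r)) (tree_size l) (tree_size l + tree_size r).+1 =
    (class_size (tkmax l) (tree_size l).-1 (tree_size l)).+1.
Proof.
rewrite class_size_node eqxx add1n [X in (_ + X)%N]count_iota0.
  rewrite addn0; congr _.+1; apply: eq_count_iota => x lt_x; rewrite tkmax_l//.
  by move: lt_x; case: (tree_size l) => // s _; rewrite eqSS.
by move=> x _; rewrite tkmax_r; lia.
Qed.

Lemma class_size_tkmax_l l r i : (i.+1 < tree_size l)%N -> 
  class_size (tkmax (Node l r)) i.+1 (tree_size l + tree_size r).+1 =
    class_size (tkmax l) i (tree_size l).
Proof.
move=> lt_i; rewrite class_size_node -[tkmax _ 0]/(tree_size l) gtn_eqF// add0n.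
rewrite [X in (_ + X)%N]count_iota0 => [|x _]; last by rewrite tkmax_r; lia.
by rewrite addn0; apply: eq_count_iota => x lt_x; rewrite tkmax_l.
Qed.

Lemma class_size_tkmax_r l r i : 
  class_size (tkmax (Node l r)) (i + (tree_size l).+1) (tree_size l + tree_size r).+1 =
    class_size (tkmax r) i (tree_size r).
Proof.
rewrite class_size_node -[tkmax _ 0]/(tree_size l).
rewrite (_ : (tree_size l == _)%N = false) ?add0n; last by lia.
rewrite count_iota0 => [|x lt_x].
  by apply: eq_count_iota => x _; rewrite tkmax_r eqn_add2r.
by rewrite tkmax_l//; have := tkmax_lt lt_x; lia.
Qed.

Section Weights.
Variable R : comPzRingType.
Implicit Types f g phi psi : nat -> R.

(* In [tree_weight f phi t] the block of 0 is still open and is weighted by phi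
   instead of f; in [tree_kweight g psi t] the same holds for the Kreweras block
   of the last element.  An absent block (empty tree) is weighted by the value at
   0, hence [closing f]. *)
Definition closing f : nat -> R := fun n => if n is _.+1 then f n else 1.

Fixpoint tree_weight f phi t : R :=
  if t is Node l r then
    tree_weight f (closing f) l * tree_weight f (phi \o succn) r
  else phi 0%N.

Fixpoint tree_kweight g psi t : R :=
  if t is Node l r then
    if r is Leaf then tree_kweight g (psi \o succn) l
    else tree_kweight g (g \o succn) l * tree_kweight g psi r
  else psi 0%N.

Lemma big_nat_node (P : pred nat) F s1 s2 :
  \prod_(1 <= i < (s1 + s2).+1 | P i) F i =
  \prod_(0 <= i < s1 | P i.+1) F i.+1 *
  \prod_(0 <= i < s2 | P (i + s1.+1)%N) F (i + s1.+1)%N :> R.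
Proof.
rewrite big_add1 /= (@big_cat_nat _ _ _ s1)//= ?leq_addr//; congr (_ * _).
rewrite -{1}[s1]add0n big_addn addKn.
by apply: eq_big => [i|i _]; rewrite -addnS.
Qed.

(** The class contains [i], so the exceptional value of [closing f] at 0 is not reached. *)
Lemma closing_class_size f (c : nat -> nat) i n :
  (i < n)%N -> c i = i -> closing f (class_size c i n) = f (class_size c i n).
Proof.
move=> lt_in ci; suff : (0 < class_size c i n)%N by case: class_size.
by rewrite -has_count; apply/hasP; exists i; rewrite ?mem_iota ?ci.
Qed.

(** The block of 0 is 0 together with the open block of [r], whence [phi \o succn]; the first block
    of [l] gets closed, whence [closing f]. *)
Lemma tree_weightE f phi t : tree_weight f phi t =
  phi (class_size (tmin t) 0 (tree_size t)) *
  \prod_(1 <= i < tree_size t | tmin t i == i) f (class_size (tmin t) i (tree_size t)).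
Proof.
elim: t phi => [|l IHl r IHr] phi; first by rewrite big_geq// mulr1.
rewrite -[tree_size (Node l r)]/(tree_size l + tree_size r).+1.
rewrite class_size_tmin0 big_nat_node mulrCA.
rewrite -[LHS]/(tree_weight f (closing f) l * tree_weight f (phi \o succn) r) IHl IHr.
congr (_ * (_ * _)).
  have [sl0|sl_gt0] := posnP (tree_size l).
    by rewrite sl0 !big_geq// mulr1 /class_size.
  rewrite closing_class_size ?tmin0// [RHS]big_ltn_cond// tmin_l// tmin0 eqxx.
  rewrite (@class_size_tmin_l l r 0)//; congr (_ * _).
  rewrite [LHS]big_nat_cond [RHS]big_nat_cond.
  apply: eq_big => [i|i /andP[/andP[_ lt_i] _]]; last by rewrite (@class_size_tmin_l l r i).
  by apply: andb_id2l => /andP[_ lt_i]; rewrite tmin_l// eqSS.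
have [sr0|sr_gt0] := posnP (tree_size r); first by rewrite sr0 !big_geq.
(* The first element of [r] is not the minimum of its block, which contains 0, so the product over
   minima skips it. *)
rewrite [RHS]big_ltn_cond// tmin_r tmin0 eqxx; case: eqP => [|_]; first by rewrite add0n.
rewrite [LHS]big_nat_cond [RHS]big_nat_cond.
apply: eq_big => [i|i /andP[/andP[i0 lt_i] _]]; last by rewrite (@class_size_tmin_r l r i).
apply: andb_id2l => /andP[i0 _]; rewrite tmin_r.
by case: (tmin r i) => [|m]; rewrite /= ?eqn_add2r//; lia.
Qed.

(** Position 0 enlarges the last Kreweras block of [l]. If [r] is empty this block stays open,
    whence [psi \o succn]; otherwise it is closed with weight [g \o succn] and the open block lies
    in [r]. *)
Lemma tree_kweightE g psi t (n := tree_size t) : tree_kweight g psi t =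
  psi (class_size (tkmax t) n.-1 n) *
  \prod_(0 <= i < n.-1 | tkmax t i == i) g (class_size (tkmax t) i n).
Proof.
rewrite {}/n; elim: t psi => [|l IHl r IHr] psi; first by rewrite big_geq// mulr1.
rewrite -[tree_size (Node l r)]/(tree_size l + tree_size r).+1 succnK.
have left_prod :
  \prod_(0 <= i < tree_size l | tkmax (Node l r) i == i)
    g (class_size (tkmax (Node l r)) i (tree_size l + tree_size r).+1) =
  \prod_(0 <= i < (tree_size l).-1 | tkmax l i == i)
    g (class_size (tkmax l) i (tree_size l)).
  have [sl0|sl_gt0] := posnP (tree_size l); first by rewrite sl0 !big_geq.
  rewrite big_ltn_cond// -[tkmax _ 0]/(tree_size l) gtn_eqF// big_add1.
  rewrite [LHS]big_nat_cond [RHS]big_nat_cond.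
  apply: eq_big => [i|i /andP[/andP[_ lt_i] _]]; last first.
    by rewrite (@class_size_tkmax_l l r i)//; lia.
  by apply: andb_id2l => /andP[_ lt_i]; rewrite tkmax_l ?eqSS//; lia.
case: r IHr left_prod => [|a b] IHr left_prod.
  rewrite addn0 in left_prod *; rewrite left_prod.
  rewrite -[X in class_size _ _ X.+1]addn0 class_size_tkmax_last.
  exact: IHl.
set r := Node a b in IHr left_prod *.
have sr_gt0 : (0 < tree_size r)%N by [].
rewrite -[LHS]/(tree_kweight g (g \o succn) l * tree_kweight g psi r) IHl IHr.
have tkmax_sl : tkmax (Node l r) (tree_size l) = tree_size l := tkmax_idem (Node l r) 0.
rewrite [X in _ = _ * X](@big_cat_nat _ _ _ (tree_size l))// ?leq_addr// left_prod.
rewrite [X in _ = _ * _ X](@big_ltn_cond _ _ _ (tree_size l)); last first.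
  by rewrite -[X in (X < _)%N]addn0 ltn_add2l.
rewrite tkmax_sl eqxx class_size_tkmax_last.
have -> : \prod_((tree_size l).+1 <= i < tree_size l + tree_size r | tkmax (Node l r) i == i)
    g (class_size (tkmax (Node l r)) i (tree_size l + tree_size r).+1) =
  \prod_(0 <= i < (tree_size r).-1 | tkmax r i == i)
    g (class_size (tkmax r) i (tree_size r)).
  rewrite -[(tree_size l).+1]add0n big_addn subnS addKn.
  rewrite [LHS]big_nat_cond [RHS]big_nat_cond.
  apply: eq_big => [i|i _]; last by rewrite (@class_size_tkmax_r l r i).
  by rewrite tkmax_r eqn_add2r.
have -> : (tree_size l + tree_size r = (tree_size r).-1 + (tree_size l).+1)%N by lia.
rewrite -[X in class_size _ _ X.+1](_ : (tree_size l + tree_size r)%N = _); last by lia.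
rewrite class_size_tkmax_r.
clearbody r.
by rewrite /= (mulrC (g _)) -!mulrA [in LHS](mulrCA (g _)) [LHS]mulrCA.
Qed.

(** As [c] is idempotent, each block contains exactly one fixed point of [c], which serves as its
    index. *)
Lemma prod_label_part n (c : nat -> nat) f :
    (forall x, (x < n)%N -> (c x < n)%N) -> (forall x, c (c x) = c x) ->
  \prod_(V in label_part (fun i : 'I_n => c i)) f #|V| =
  \prod_(0 <= i < n | c i == i) f (class_size c i n).
Proof.
move=> c_lt c_idem; pose A (i : 'I_n) := [set y : 'I_n | c y == i].
have -> : label_part (fun i : 'I_n => c i) = A @: [pred i : 'I_n | c i == i].
  apply/setP => V; apply/mem_label_part/imsetP => -[i].
    move=> ->; exists (Ordinal (c_lt _ (ltn_ord i))); first by rewrite inE /= c_idem.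
    by apply/setP => y; rewrite !inE eq_sym.
  by rewrite inE => /eqP ci ->; exists i; apply/setP => y; rewrite !inE ci eq_sym.
rewrite big_imset /= => [|i j]; last first.
  rewrite !inE => /eqP ci /eqP cj /setP/(_ i); rewrite !inE ci eqxx => /esym/eqP.
  exact: val_inj.
rewrite big_mkord; apply: eq_big => // i _; congr f.
rewrite /class_size cardE /enum_mem size_filter -val_enum_ord count_map.
by rewrite -enumT; apply: eq_count => y; rewrite /= inE.
Qed.

Lemma prod_tree_part n f t : tree_size t = n.+1 ->
  \prod_(V in tree_part n.+1 t) f #|V| = tree_weight f f t.
Proof.
move=> sz_t; have t_gt0 : (0 < tree_size t)%N by rewrite sz_t.
rewrite -{n}sz_t prod_label_part => [|x lt_x|x]; last exact: tmin_idem.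
  by rewrite big_ltn_cond// tmin0 eqxx tree_weightE.
by apply: leq_ltn_trans lt_x; apply: tmin_le.
Qed.

Lemma prod_tree_kpart n g t : tree_size t = n.+1 ->
  \prod_(V in tree_kpart n.+1 t) g #|V| = tree_kweight g g t.
Proof.
move=> sz_t; have t_gt0 : (0 < tree_size t)%N by rewrite sz_t.
rewrite -{n}sz_t prod_label_part => [|x|x]; last exact: tkmax_idem.
  rewrite (@big_cat_nat _ _ _ (tree_size t).-1)//= ?leq_pred// tree_kweightE mulrC.
  by rewrite big_ltn_cond ?prednK// big_geq ?prednK// tkmax_last eqxx mulr1.
exact: tkmax_lt.
Qed.

Lemma tree_part_inj n t u : tree_size t = n -> tree_size u = n ->
  tree_part n t = tree_part n u -> t = u.
Proof.
move=> sz_t sz_u eq_tu; apply: tmin_inj => [|x y]; rewrite ?sz_t ?sz_u// => lt_x lt_y.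
exact: (label_part_inj eq_tu (Ordinal lt_x) (Ordinal lt_y)).
Qed.

(** Reindexing along the bijection between trees with [n] nodes and [NC n]. *)
Lemma sum_NC_trees n (F : {set {set 'I_n}} -> R) :
  \sum_(P in NC n) F P = \sum_(t <- trees n n) F (tree_part n t).
Proof.
rewrite -(big_map (tree_part n) xpredT F) -big_enum.
apply/perm_big/uniq_perm; rewrite ?enum_uniq//.
  rewrite map_inj_in_uniq ?trees_uniq// => t u.
  by rewrite !mem_trees// => /eqP sz_t /eqP sz_u; apply: tree_part_inj.
move=> P; rewrite mem_enum; apply/idP/mapP => [/NC_tree_part[t sz_t ->]|[t _ ->]].
  by exists t; rewrite ?mem_trees ?sz_t.
exact: tree_part_NC.
Qed.

(** The weights of the open blocks are parameters because the recursion changes them; in positive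
    degree, boxed convolution is the case [phi = f], [psi = g]. *)
Definition weight_sum f g phi psi n : R :=
  \sum_(t <- trees n n) tree_weight f phi t * tree_kweight g psi t.

Lemma boxtimes_weight_sum f g n : boxtimes f g n.+1 = weight_sum f g f g n.+1.
Proof.
rewrite /boxtimes /= sum_NC_trees; apply: eq_big_seq => t.
rewrite mem_trees// => /eqP sz_t; rewrite (kreweras_tree sz_t).
by rewrite prod_tree_part ?prod_tree_kpart.
Qed.

Lemma weight_sum_upto f g phi psi n d : (n <= d)%N ->
  \sum_(t <- trees_upto d | tree_size t == n) tree_weight f phi t * tree_kweight g psi t
    = weight_sum f g phi psi n.
Proof.
move=> le_nd; rewrite /weight_sum -big_filter; apply: perm_big.
exact: trees_perm.
Qed.

Lemma weight_sum0 f g phi psi : weight_sum f g phi psi 0 = phi 0%N * psi 0%N.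
Proof. by rewrite /weight_sum big_seq1. Qed.

Lemma sum_trees_uptoS d (F : bintree -> R) :
  \sum_(t <- trees_upto d.+1) F t =
    F Leaf + \sum_(l <- trees_upto d) \sum_(r <- trees_upto d) F (Node l r).
Proof. by rewrite /= big_cons big_allpairs_dep. Qed.

Lemma sum_trees_split n (F : bintree -> R) :
  \sum_(t <- trees_upto n.+1 | tree_size t == n.+1) F t =
  \sum_(i < n.+1) \sum_(l <- trees_upto n | tree_size l == i)
    \sum_(r <- trees_upto n | (tree_size r == n - i)%N) F (Node l r).
Proof.
rewrite big_mkcond sum_trees_uptoS /= add0r.
transitivity (\sum_(l <- trees_upto n) \sum_(r <- trees_upto n) \sum_(i < n.+1)
    if (tree_size l == i) && (tree_size r == n - i)%N then F (Node l r) else 0).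
  apply: eq_bigr => l _; apply: eq_bigr => r _ /=; rewrite eqSS -big_mkcond.
  case: eqP => [sz_n|sz_n]; last by rewrite big_pred0// => -[i lt_i] /=; lia.
  have lt_l : (tree_size l < n.+1)%N by lia.
  rewrite (big_pred1 (Ordinal lt_l))// => i; apply/idP/eqP => [h|->]; last by rewrite /=; lia.
  by apply: val_inj => /=; lia.
transitivity (\sum_(l <- trees_upto n) \sum_(i < n.+1) \sum_(r <- trees_upto n)
    if (tree_size l == i) && (tree_size r == n - i)%N then F (Node l r) else 0).
  by apply: eq_bigr => l _; apply: exchange_big.
rewrite [LHS]exchange_big; apply: eq_bigr => i _; rewrite [RHS]big_mkcond.
apply: eq_bigr => l _; case: eqP => _ /=; last by rewrite big1.
by rewrite -big_mkcond.
Qed.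

(** The sum is split by the size [i] of the left subtree. The case [i = n], where the right subtree
    is empty, gives the separate first term. *)
Lemma weight_sumS f g phi psi n : weight_sum f g phi psi n.+1 =
  phi 1%N * weight_sum f g (closing f) (psi \o succn) n +
  \sum_(i < n) weight_sum f g (closing f) (g \o succn) i *
              weight_sum f g (phi \o succn) psi (n - i).
Proof.
rewrite -(weight_sum_upto _ _ _ _ (leqnn n.+1)) sum_trees_split big_ord_recr /= [LHS]addrC.
congr (_ + _).
  rewrite /= -(weight_sum_upto _ _ _ _ (leqnn n)) big_distrr; apply: eq_bigr => l _ /=.
  rewrite subnn -big_filter (perm_big _ (trees_perm (leq0n n))) big_seq1 /=.
  by rewrite mulrAC mulrC.
apply: eq_bigr => i _; rewrite -(weight_sum_upto _ _ _ _ (ltnW (ltn_ord i))).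
rewrite -(weight_sum_upto _ _ _ _ (leq_subr i n)) big_distrlr.
apply: eq_bigr => l _; apply: eq_bigr => -[|a b] /= => [/eqP|_]; first by have := ltn_ord i; lia.
by rewrite mulrACA.
Qed.
End Weights.

(** * Boxed convolution *)

Section Boxtimes.
Variable R : comPzRingType.
Implicit Types f g h m u v P Q H : series R.

Local Notation "'Z" := (fps_z R : series R).
Local Notation D := (@fps_divz R : series R -> series R).
Local Infix "\oc" := (@fps_comp R : series R -> series R -> series R) (at level 35).
Local Infix "\box" := (@boxtimes R : series R -> series R -> series R) (at level 35).

Local Notation cinv := (@fps_compinv R : series R -> series R).
Local Notation F := (@calF R : series R -> series R).

(** [weight_sumS] is a Horner step in [P] for [phi], and splitting the constant term of
    [X (closing f) (D psi)] is a Horner step in [Q] for [psi]. Both are run together by induction on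
    precision. *)
Lemma divz_weight_sum f g phi psi :
  let X phi psi : series R := weight_sum f g phi psi in
  let P := 'Z * X (closing f) (D g) in let Q := 'Z * (D f \oc P) in
  D (X phi psi) = (D phi \oc P) * (D psi \oc Q).
Proof.
move=> X P Q; have P0 : P 0%N = 0 := mulz_coef0 _; have Q0 : Q 0%N = 0 := mulz_coef0 _.
have recX p q : D (X p q) = fps_const (p 1%N) * X (closing f) (D q) + P * D (X (D p) q).
  apply/funext => n; rewrite coefDs fps_constM -[LHS]/(X p q n.+1) /X weight_sumS.
  congr (_ + _); rewrite coefMs big_ord_recl P0 mul0r add0r.
  by apply: eq_bigr => i _; rewrite /P mulz_coefS /fps_divz subnSK.
(* The constant term is [closing f 0 * q 1], and [closing f 0] is 1. *)
have splitX q : X (closing f) (D q) = fps_const (q 1%N) + 'Z * D (X (closing f) (D q)).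
  by rewrite [LHS]fps_split /X weight_sum0 mul1r.
apply: agree_eq => n; elim: n phi psi => // n IH phi psi.
have IHX : agree n.+1 (X (closing f) (D psi)) (D psi \oc Q).
  rewrite splitX (comp_split _ Q0) /Q -mulrA; apply: agree_add => //.
  by apply: agree_mul_M1 => //; apply: IH.
rewrite recX (comp_split (D phi) P0) mulrDl -mulrA.
by apply: agree_add; [apply: agree_mul|apply: agree_mul_M1].
Qed.

Lemma boxtimes_system f g : exists P Q,
  [/\ P 0%N = 0, Q 0%N = 0, P = 'Z * (D g \oc Q), Q = 'Z * (D f \oc P) &
      f \box g = 'Z * (D f \oc P) * (D g \oc Q)].
Proof.
pose P := 'Z * (weight_sum f g (closing f) (D g) : series R).
pose Q := 'Z * (D f \oc P).
have DX phi psi := divz_weight_sum f g phi psi; rewrite /= -/P -/Q in DX.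
have P0 : P 0%N = 0 := mulz_coef0 _; have Q0 : Q 0%N = 0 := mulz_coef0 _.
exists P, Q; split=> //; last first.
  rewrite -mulrA -DX -[LHS]mulz_divz//; congr ('Z * _); apply/funext => n.
  exact: boxtimes_weight_sum.
rewrite {1}/P; congr ('Z * _).
(* Since [D (closing f)] is [D f], the split series is the Horner expansion of [D g] at [Q]. *)
rewrite [LHS]fps_split DX weight_sum0 mul1r (comp_split (D g) Q0).
by rewrite /Q -mulrA.
Qed.

Lemma boxtimes_comp f g : f 0%N = 0 -> g 0%N = 0 -> exists P Q,
  [/\ P 0%N = 0, Q 0%N = 0, P = 'Z * (D g \oc Q), P * Q = 'Z * (f \box g) &
      f \box g = f \oc P /\ f \box g = g \oc Q].
Proof.
move=> f0 g0; have [P [Q [P0 Q0 EP EQ EH]]] := boxtimes_system f g.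
exists P, Q; split=> //.
  by rewrite EH -EQ mulrCA -EP mulrC.
split; rewrite EH; first by rewrite mulrAC -EP -comp_mulz// mulz_divz.
by rewrite -EQ -comp_mulz// mulz_divz.
Qed.

Lemma boxtimes_coef1 f g : (f \box g) 1%N = f 1%N * g 1%N.
Proof.
have [P [Q [P0 Q0 _ _ ->]]] := boxtimes_system f g.
by rewrite -mulrA mulz_coefS coef0M !comp_coef0.
Qed.

Lemma G1P f : reflect (f 0%N = 0 /\ f 1%N = 1) (f \in G1 R).
Proof. by rewrite inE; apply: (iffP andP) => -[/eqP ? /eqP]. Qed.

Lemma M1P f : reflect (f 0%N = 0) (f \in M1 R).
Proof. by rewrite inE; apply: eqP. Qed.

Lemma G1_M1 f : f \in G1 R -> f \in M1 R.
Proof. by case/G1P => f0 _; apply/M1P. Qed.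

Lemma boxtimes_G1 f g : f \in G1 R -> g \in G1 R -> f \box g \in G1 R.
Proof.
by move=> /G1P[f0 f1] /G1P[g0 g1]; apply/G1P; rewrite boxtimes_coef1 f1 g1 mulr1.
Qed.

Lemma fps_z_G1 : 'Z \in G1 R. Proof. exact/G1P. Qed.

(** The right inverse [g] has a right inverse [h] of its own, and associativity gives [f = h]. *)
Lemma comp_inv_exists f : f \in G1 R ->
  exists g, [/\ g \in G1 R, f \oc g = 'Z & g \oc f = 'Z].
Proof.
move=> /G1P[f0 f1]; have [g [g0 g1 fg]] := comp_rinv_exists f0 f1.
have [h [h0 h1 gh]] := comp_rinv_exists g0 g1.
exists g; split=> //; first exact/G1P.
suff -> : f = h by [].
by rewrite -[LHS]compsz -gh compA// fg compzs.
Qed.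

Lemma comp_inv_unique f g h : f 0%N = 0 -> g 0%N = 0 -> h 0%N = 0 ->
  g \oc f = 'Z -> f \oc h = 'Z -> h = g.
Proof. by move=> f0 g0 h0 gf fh; rewrite -[g]compsz -fh compA// gf compzs. Qed.

Lemma compinv_spec f : f \in G1 R ->
  [/\ cinv f \in G1 R, f \oc cinv f = 'Z & cinv f \oc f = 'Z].
Proof.
move=> Gf; have [g [Gg fg gf]] := comp_inv_exists Gf.
have [] := ClassicalEpsilon.epsilon_spec (inhabits f) (fun g =>
  [/\ g \in M1 R, fps_comp f g = fps_z R & fps_comp g f = fps_z R]).
  by exists g; split=> //; apply: G1_M1.
rewrite -/(fps_compinv f) => /M1P c0 fc cf; split=> //.
have /G1P[f0 _] := Gf; have /G1P[g0 _] := Gg.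
(* The chosen inverse is only known to lie in [M1]; uniqueness identifies it with [g], which lies in
   [G1]. *)
by rewrite (@comp_inv_unique f g (cinv f)).
Qed.

Lemma compinvP f g : f \in G1 R -> g 0%N = 0 -> f \oc g = 'Z -> cinv f = g.
Proof.
move=> Gf g0 fg; have [/G1P[c0 _] fc cf] := compinv_spec Gf.
by have /G1P[f0 _] := Gf; rewrite (comp_inv_unique f0 c0 g0 cf fg).
Qed.

Lemma mulz_calF f : f \in G1 R -> 'Z * F f = cinv f.
Proof. by move=> /compinv_spec[/G1P[c0 _] _ _]; apply: mulz_divz. Qed.

Lemma calF_Lambda f : f \in G1 R -> F f \in Lambda R.
Proof. by move=> /compinv_spec[/G1P[_ c1] _ _]; apply/eqP. Qed.

Lemma calF_boxtimes f g : f \in G1 R -> g \in G1 R ->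
  F (f \box g) = F f * F g.
Proof.
move=> Gf Gg; have Gh := boxtimes_G1 Gf Gg; set h := f \box g in Gh *.
have [/G1P[f0 _] /G1P[g0 _] /G1P[h0 _]] := And3 Gf Gg Gh.
have [P [Q [P0 Q0 _ EPQ [EP EQ]]]] := boxtimes_comp f0 g0.
have [/G1P[cf0 _] _ cf] := compinv_spec Gf.
have [/G1P[cg0 _] _ cg] := compinv_spec Gg.
have [/G1P[ch0 _] hc ch] := compinv_spec Gh.
have {}EP : cinv f \oc h = P by rewrite /h EP compA// cf compzs.
have {}EQ : cinv g \oc h = Q by rewrite /h EQ compA// cg compzs.
(* Two factors [z] turn each [F] into a compositional inverse. The resulting identity is checked
   after substituting [h], which [cinv h] undoes. *)
do 2!apply: mulz_inj; rewrite (mulz_calF Gh) [RHS]mulrA mulrACA.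
rewrite (mulz_calF Gf) (mulz_calF Gg).
suff /(congr1 (fun u => u \oc cinv h)) :
    ('Z * cinv h) \oc h = (cinv f * cinv g) \oc h.
  by rewrite -!(compA _ h0 ch0) hc !compsz.
by rewrite !compM// EP EQ EPQ compzs// ch mulrC.
Qed.

Lemma calF_inj : {in G1 R &, injective F}.
Proof.
move=> f g Gf Gg eqF; have [/G1P[c0 _] fc cf] := compinv_spec Gf.
have [_ gc cg] := compinv_spec Gg.
have eq_c : cinv f = cinv g by rewrite -!mulz_calF ?eqF.
have [/G1P[f0 _] /G1P[g0 _]] := conj Gf Gg.
by rewrite -eq_c in gc; apply: (comp_inv_unique c0 g0 f0).
Qed.

(** The preimage is the compositional inverse of [z u]. *)
Lemma calF_surj u : u \in Lambda R -> exists2 f, f \in G1 R & F f = u.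
Proof.
move=> /eqP u0.
have Gz : 'Z * u \in G1 R by apply/G1P; rewrite mulz_coef0 mulz_coefS.
have [f [Gf zf fz]] := comp_inv_exists Gz; exists f => //.
rewrite /F (@compinvP f ('Z * u)) ?mulz_coef0//; exact: divz_mulz.
Qed.

Lemma calF_z : F 'Z = 1.
Proof.
by rewrite /F (@compinvP 'Z 'Z) ?compsz ?fps_z_G1//; rewrite -[X in D X]mulr1 divz_mulz.
Qed.

(** Eliminates [Q] from the system of [boxtimes_comp]: with [H = g(Q)], the factor [(g/z)(Q)] of [P]
    is inverse to [F(g)(H)]. *)
Lemma boxtimes_right_system m g : m \in M1 R -> g \in G1 R -> exists P,
  [/\ P 0%N = 0, m \box g = m \oc P & P * (F g \oc (m \box g)) = 'Z].
Proof.
move=> /M1P m0 Gg; have /G1P[g0 _] := Gg.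
have [P [Q [P0 Q0 EP _ [HP HQ]]]] := boxtimes_comp m0 g0.
exists P; split=> //; rewrite HQ {1}EP compA// -mulrA -compM//.
rewrite (_ : D g * (F g \oc g) = 1) ?comp1s ?mulr1//.
apply: mulz_inj; rewrite mulrA mulz_divz// -(comp_mulz _ g0) mulz_calF//.
by have [_ _ ->] := compinv_spec Gg; rewrite mulr1.
Qed.

(** Solving for [P = z v(H)] with [v] the inverse of [u] leaves [H = m(z v(H))], the fixed point
    equation of a contraction. *)
Lemma right_system_unique m u P H P' H' : u 0%N = 1 ->
  H = m \oc P -> P * (u \oc H) = 'Z -> H' = m \oc P' -> P' * (u \oc H') = 'Z ->
  H 0%N = 0 -> H' 0%N = 0 -> H = H'.
Proof.
move=> u0 EH EP EH' EP' H0 H'0; have [v uv] := inv_exists u0.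
pose Phi K := m \oc ('Z * (v \oc K)).
have fixP K L : K 0%N = 0 -> K = m \oc L -> L * (u \oc K) = 'Z -> Phi K = K.
  move=> K0 EK EL; rewrite /Phi -EL -mulrA -compM// uv comp1s mulr1.
  by rewrite -EK.
apply: (@contraction_unique _ Phi); [|exact: fixP EH EP|exact: fixP EH' EP'].
move=> n a b hab; apply: agree_comp => //; apply: agree_mul_M1 => //.
exact: agree_comp.
Qed.

(** Both sides solve the system of [m] with [F (g \box h) = F g * F h]; on the left the inner series
    is the composite of the two inner series. *)
Lemma boxtimes_assoc_M1 m g h : m \in M1 R -> g \in G1 R -> h \in G1 R ->
  (m \box g) \box h = m \box (g \box h).
Proof.
move=> Mm Gg Gh; have Mmg : m \box g \in M1 R by apply/M1P.
have [P [P0 EP uP]] := boxtimes_right_system Mm Gg.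
have [Q [Q0 EQ uQ]] := boxtimes_right_system Mmg Gh.
have [K [K0 EK uK]] := boxtimes_right_system Mm (boxtimes_G1 Gg Gh).
apply: (@right_system_unique m (F (g \box h)) (P \oc Q) _ K) => //.
- by apply/eqP/(calF_Lambda (boxtimes_G1 Gg Gh)).
- by rewrite compA// -EP.
- rewrite calF_boxtimes// compM// mulrA -[RHS]uQ; congr (_ * _).
  by rewrite EQ compA// -compM// uP compzs.
Qed.

Lemma boxtimes_z m : m \in M1 R -> m \box 'Z = m.
Proof.
move=> Mm; have [P [P0 EP]] := boxtimes_right_system Mm fps_z_G1.
by rewrite calF_z comp1s mulr1 => E; rewrite EP E compsz.
Qed.
End Boxtimes.

(** * The logarithmic derivative *)

Section Logarithm.
Variable R : comPzRingType.
Implicit Types f g u v w : series R.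

Local Notation "'Z" := (fps_z R : series R).
Local Notation D := (@fps_divz R : series R -> series R).
Local Notation deriv := (@fps_deriv R : series R -> series R).
Local Notation inv := (@fps_inv R : series R -> series R).
Local Notation dlog := (@dlog R : series R -> series R).

Lemma derivD u v : deriv (u + v) = deriv u + deriv v.
Proof. by apply/funext => n; apply: mulrnDl. Qed.

Lemma deriv_const c u : deriv (fps_const c * u) = fps_const c * deriv u.
Proof. by apply/funext => n; rewrite fps_constM /fps_deriv fps_constM mulrnAr. Qed.

Lemma deriv_mulz u : deriv ('Z * u) = u + 'Z * deriv u.
Proof.
apply/funext => -[|n]; rewrite coefDs /fps_deriv mulz_coefS; first by rewrite mulz_coef0 addr0.
by rewrite mulz_coefS mulrS.
Qed.

Lemma deriv_const0 c : deriv (fps_const c) = 0.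
Proof. by apply/funext => n; apply: mul0rn. Qed.

Lemma deriv_split u : deriv u = D u + 'Z * deriv (D u).
Proof.
by rewrite {1}(fps_split u) derivD deriv_mulz deriv_const0 add0r.
Qed.

(** After the constant term of [u] is split off, the rule for [D u] and [v] appears behind a factor
    [z]. *)
Lemma derivM u v : deriv (u * v) = deriv u * v + u * deriv v.
Proof.
apply: agree_eq => n; elim: n u => // n IH u.
have -> : deriv u * v + u * deriv v = fps_const (u 0%N) * deriv v +
    (D u * v + 'Z * (deriv (D u) * v + D u * deriv v)).
  rewrite [deriv u]deriv_split [X in X * deriv v]fps_split !mulrDl mulrDr !mulrA.
  by rewrite [RHS]addrCA [X in _ = _ + X]addrCA -addrA.
rewrite {1}(fps_split u) mulrDl derivD deriv_const -mulrA deriv_mulz.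
by do 2!apply: agree_add => //; apply: agree_mul_M1.
Qed.

Lemma LambdaP u : reflect (u 0%N = 1) (u \in Lambda R).
Proof. exact: eqP. Qed.

Lemma fps_invP u : u \in Lambda R -> u * inv u = 1.
Proof.
move=> /LambdaP/inv_exists[v uv].
by apply: (ClassicalEpsilon.epsilon_spec (inhabits u) (fun v => fps_mul u v = fps_one R)); exists v.
Qed.

Lemma inv_unique u v w : u * v = 1 -> u * w = 1 -> v = w.
Proof. by move=> uv uw; rewrite -[v]mulr1 -uw mulrCA mulrA uv mul1r. Qed.

Lemma LambdaM u v : u \in Lambda R -> v \in Lambda R -> u * v \in Lambda R.
Proof. by move=> /LambdaP u0 /LambdaP v0; apply/LambdaP; rewrite coef0M u0 v0 mulr1. Qed.

Lemma inv_Lambda u : u \in Lambda R -> inv u \in Lambda R.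
Proof.
move=> Lu; have /LambdaP u0 := Lu; have := congr1 (fun w => w 0%N) (fps_invP Lu).
by rewrite coef0M u0 mul1r => u1; apply/LambdaP.
Qed.

Lemma dlogE u : dlog u = deriv u * inv u. Proof. by []. Qed.

Lemma dlogM u v : u \in Lambda R -> v \in Lambda R -> dlog (u * v) = dlog u + dlog v.
Proof.
move=> Lu Lv; have uu := fps_invP Lu; have vv := fps_invP Lv.
have -> : dlog (u * v) = deriv (u * v) * (inv u * inv v).
  rewrite dlogE (@inv_unique _ _ _ (fps_invP (LambdaM Lu Lv)) (_ : u * v * (inv u * inv v) = 1))//.
  by rewrite mulrACA uu vv mulr1.
rewrite derivM mulrDl mulrACA vv mulr1 -dlogE; congr (_ + _).
by rewrite mulrACA uu mul1r.
Qed.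

(** Trades the inverse series for the linear differential equation [u' = a u]. *)
Lemma dlog_deriv u a : u \in Lambda R -> dlog u = a <-> deriv u = a * u.
Proof.
move=> /fps_invP uu; split=> [<-|du]; first by rewrite dlogE -mulrA (mulrC (inv u)) uu mulr1.
by rewrite dlogE du -mulrA uu mulr1.
Qed.

Variable iR : {rmorphism rat -> R}.

Definition fps_int w : series R :=
  fun n => if n is k.+1 then w k * iR (k.+1%:R^-1) else 0.

Lemma ratr_natV k : iR (k.+1%:R^-1) *+ k.+1 = 1.
Proof. by rewrite -rmorphMn -mulr_natl mulfV ?rmorph1// Num.Theory.pnatr_eq0. Qed.

Lemma deriv_int w : deriv (fps_int w) = w.
Proof. by apply/funext => n; rewrite /fps_deriv /= -mulrnAr ratr_natV mulr1. Qed.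

Lemma int_deriv u : u = fps_const (u 0%N) + fps_int (deriv u).
Proof.
apply/funext => -[|n]; rewrite coefDs /=; first by rewrite addr0.
by rewrite add0r /fps_deriv mulrnAl -mulrnAr ratr_natV mulr1.
Qed.

(** Picard iteration for [u' = a u] with [u(0) = 1]; integration gains one degree. Its unique fixed
    point gives both injectivity and surjectivity of [dlog]. *)
Lemma ode_contraction a : contraction (fun u => fps_const 1 + fps_int (a * u)).
Proof.
move=> n u v huv; apply: agree_add => // -[|i] //=; rewrite ltnS => lt_in.
by congr (_ * _); apply: agree_mul lt_in.
Qed.

Lemma dlog_fixpoint u a : u \in Lambda R -> dlog u = a ->
  fps_const 1 + fps_int (a * u) = u.
Proof.
by move=> Lu /(dlog_deriv _ Lu) <-; have /LambdaP <- := Lu; rewrite -int_deriv.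
Qed.

Lemma dlog_inj : {in Lambda R &, injective dlog}.
Proof.
move=> u v Lu Lv eq_uv; apply: (contraction_unique (@ode_contraction (dlog u))).
  exact: dlog_fixpoint.
by apply: dlog_fixpoint.
Qed.

Lemma dlog_surj a : exists2 u, u \in Lambda R & dlog u = a.
Proof.
have [u Pu] := contraction_fixpoint (@ode_contraction a).
have Lu : u \in Lambda R by apply/LambdaP; rewrite -Pu coefDs addr0.
exists u => //; apply/(dlog_deriv _ Lu); by rewrite -{1}Pu derivD deriv_int deriv_const0 add0r.
Qed.

End Logarithm.

(** * Isomorphisms *)

Section GroupIso.
Variables (T U V : Type) (A : {pred T}) (opA : T -> T -> T).
Variables (B : {pred U}) (opB : U -> U -> U) (C : {pred V}) (opC : V -> V -> V).

(** The group laws of [A] are pulled back along the bijection, so associativity and commutativity of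
    the boxed operations need no combinatorial proof. *)
Lemma group_iso_transport (phi : T -> U) :
    abelian_group_on B opB ->
    {in A &, forall x y, opA x y \in A} ->
    {homo phi : x / x \in A >-> x \in B} ->
    {in A &, {morph phi : x y / opA x y >-> opB x y}} ->
    {in A &, injective phi} ->
    {in B, forall y, exists2 x, x \in A & phi x = y} ->
  group_iso A opA B opB phi.
Proof.
move=> gB closA homA morphA injA surjA; split=> //; split=> //.
have [_ assocB commB [e Be [e1 invB]]] := gB.
split=> // [x y z Ax Ay Az|x y Ax Ay|].
- by apply: injA; rewrite ?closA// !morphA ?closA// assocB ?homA.
- by apply: injA; rewrite ?closA// !morphA// commB ?homA.
have [a Aa phia] := surjA e Be; exists a => //.
split=> [x Ax|x Ax]; first by apply: injA; rewrite ?closA// morphA// phia e1 ?homA.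
have [b Bb bx] := invB _ (homA _ Ax); have [y Ay phiy] := surjA b Bb.
by exists y => //; apply: injA; rewrite ?closA// morphA// phiy bx.
Qed.

Lemma group_iso_comp (phi : T -> U) (psi : U -> V) :
    group_iso A opA B opB phi -> group_iso B opB C opC psi ->
  group_iso A opA C opC (psi \o phi).
Proof.
move=> [[gA gB] homA morphA injA surjA] [[_ gC] homB morphB injB surjB].
split=> //= [x Ax|x y Ax Ay|x y Ax Ay|z Cz].
- exact/homB/homA.
- by rewrite /= morphA// morphB// homA.
- by move=> /(injB _ _ (homA _ Ax) (homA _ Ay)); apply: injA.
have [y By <-] := surjB z Cz; have [x Ax <-] := surjA y By.
by exists x.
Qed.

(** [chi] is the inverse of [psi] after [phi], so each commuting triangle of the diagram yields its
    third side. *)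
Lemma group_iso_factor (phi : T -> V) (psi : U -> V) (chi : T -> U) :
    group_iso A opA C opC phi -> group_iso B opB C opC psi ->
    {homo chi : x / x \in A >-> x \in B} -> {in A, forall x, psi (chi x) = phi x} ->
  group_iso A opA B opB chi.
Proof.
move=> [[gA gC] homA morphA injA surjA] [[gB _] homB morphB injB surjB] homc E.
have [closA _ _ _] := gA; have [closB _ _ _] := gB.
split=> // [x y Ax Ay|x y Ax Ay exy|y By].
- by apply: injB; rewrite ?homc ?closA ?closB ?homc// morphB ?homc// !E ?closA// morphA.
- by apply: injA => //; rewrite -!E// exy.
have [x Ax phix] := surjA _ (homB _ By); exists x => //.
by apply: injB; rewrite ?homc// E.
Qed.

End GroupIso.

Section Isomorphisms.
Variable R : comPzRingType.
Implicit Types f g m u : series R.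

Local Notation "'Z" := (fps_z R : series R).
Local Infix "\box" := (@boxtimes R : series R -> series R -> series R) (at level 35).
Local Notation F := (@calF R : series R -> series R).
Local Notation zeta := (Zeta1 R : series R).
Local Notation moeb := (Moeb1 R : series R).

Lemma Lambda_group : abelian_group_on (Lambda R) (@fps_mul R).
Proof.
split=> [u v||u v _ _|]; [exact: LambdaM|by move=> u v w _ _ _; apply: fps_mulA|exact: fps_mulC|].
exists (1 : series R); first exact/LambdaP.
split=> [u _|u Lu]; first exact: fps_mul1.
by exists (fps_inv u); [apply: inv_Lambda|rewrite fps_mulC; apply: fps_invP].
Qed.

Lemma fps_all_group : abelian_group_on (fps_all R) (@fps_add R).
Proof.
split=> // [u v w _ _ _|u v _ _|]; [exact: fps_addA|exact: fps_addC|].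
exists (0 : series R) => //; split=> [u _|u _]; first exact: fps_add0.
by exists (- (u : series R)) => //; apply: fps_addN.
Qed.

Lemma divz_iso : group_iso (M1 R) (@fps_add R) (fps_all R) (@fps_add R) (@fps_divz R).
Proof.
apply: group_iso_transport; first exact: fps_all_group.
- by move=> u v /M1P u0 /M1P v0; apply/M1P; rewrite /fps_add u0 v0 addr0.
- by [].
- by [].
- move=> u v /M1P u0 /M1P v0 eq_uv.
  by rewrite -[u](mulz_divz u0) eq_uv (mulz_divz v0).
by move=> u _; exists ('Z * (u : series R)); [apply/M1P/mulz_coef0|apply: divz_mulz].
Qed.

Lemma calF_iso : group_iso (G1 R) (@boxtimes R) (Lambda R) (@fps_mul R) (@calF R).
Proof.
apply: group_iso_transport; [exact: Lambda_group|exact: boxtimes_G1|exact: calF_Lambda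
  |exact: calF_boxtimes|exact: calF_inj|exact: calF_surj].
Qed.

Lemma boxtimes_group : abelian_group_on (G1 R) (@boxtimes R).
Proof. by have [[]] := calF_iso. Qed.

Lemma boxtimesC : {in G1 R &, commutative (@boxtimes R)}.
Proof. by have [] := boxtimes_group. Qed.

Lemma Zeta1_G1 : zeta \in G1 R. Proof. exact/G1P. Qed.

(** Zeta is [z/(1 - z)], whose compositional inverse is [z/(1 + z)]. *)
Lemma calF_Zeta1 : (1 + 'Z) * F zeta = 1.
Proof.
have [v zv] := @inv_exists R (1 + 'Z) (addr0 _).
suff -> : F zeta = v by [].
have c0 : ('Z * v) 0%N = 0 := mulz_coef0 _.
rewrite /calF (@compinvP _ zeta ('Z * v)) ?Zeta1_G1 ?divz_mulz//.
have zeta_geom : zeta = 'Z + 'Z * zeta.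
  by apply/funext => -[|[|n]]; rewrite coefDs ?mulz_coef0 ?mulz_coefS ?addr0 ?add0r.
have vE : v = 1 - 'Z * v by apply/eqP; rewrite eq_sym subr_eq -{1}[v]mul1r -mulrDl zv.
pose W : series R := fps_comp zeta ('Z * v).
(* The geometric recursion of zeta at [z v]; with [v = 1 - z v] it becomes [W v = z v], and [v] is
   cancelled by [1 + z]. *)
have E : W = 'Z * v + 'Z * v * W by rewrite /W {1}zeta_geom compD compM// compzs.
have {}E : W * v = 'Z * v.
  by rewrite [X in _ * X = _]vE mulrBr mulr1 [X in X - _]E (mulrC W) addrK.
suff: W = 'Z by [].
by rewrite -[LHS]mulr1 -zv (mulrC _ v) mulrA E -mulrA (mulrC v) zv mulr1.
Qed.

Lemma Moeb1_spec : [/\ moeb \in G1 R, zeta \box moeb = 'Z & F moeb = 1 + 'Z].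
Proof.
have [|mu Gmu Fmu] := @calF_surj R (1 + 'Z); first by apply/LambdaP; apply: addr0.
have zmu : zeta \box mu = 'Z.
  apply: calF_inj; rewrite ?boxtimes_G1 ?fps_z_G1 ?Zeta1_G1//.
  by rewrite calF_boxtimes ?Zeta1_G1// calF_z Fmu mulrC calF_Zeta1.
have [] := ClassicalEpsilon.epsilon_spec (inhabits zeta) (fun g =>
  [/\ g \in M1 R, boxtimes (Zeta1 R) g = fps_z R & boxtimes g (Zeta1 R) = fps_z R]).
  by exists mu; rewrite (boxtimesC Gmu Zeta1_G1); split=> //; apply: G1_M1.
rewrite -/(Moeb1 R) => /M1P m0 zm _.
(* The choice only ensures membership in [M1]; the coefficient of [z] in zeta boxed with [moeb]
   gives the leading coefficient 1. *)
have Gm : moeb \in G1 R.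
  apply/G1P; split=> //; have := congr1 (fun u : series R => u 1%N) zm.
  by rewrite boxtimes_coef1 mul1r.
split=> //; have := calF_boxtimes Zeta1_G1 Gm; rewrite zm calF_z => E.
suff: (1 + 'Z) * F zeta * F moeb = 1 + 'Z by rewrite calF_Zeta1 mul1r.
by rewrite -mulrA -E mulr1.
Qed.

Lemma Moeb1_G1 : moeb \in G1 R. Proof. by have [] := Moeb1_spec. Qed.

(** Valid on all of [M1] because right boxed convolution by [G1] is an action there. *)
Lemma boxtimes_Zeta1K : {in M1 R, cancel (fun m => m \box zeta) (fun m => m \box moeb)}.
Proof.
move=> m Mm /=; have [Gm zm _] := Moeb1_spec.
by rewrite boxtimes_assoc_M1 ?Zeta1_G1// zm boxtimes_z.
Qed.

Lemma boxtimes_Moeb1K : {in M1 R, cancel (fun m => m \box moeb) (fun m => m \box zeta)}.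
Proof.
move=> m Mm /=; have [Gm zm _] := Moeb1_spec.
by rewrite boxtimes_assoc_M1 ?Zeta1_G1// (boxtimesC Gm Zeta1_G1) zm boxtimes_z.
Qed.

Lemma boxtimes_M1 f g : f \box g \in M1 R. Proof. exact/M1P. Qed.

(** The factor [1 + z] in [S_V] is [F moeb]. *)
Lemma S_VE f : f \in G1 R -> S_V f = F (f \box moeb).
Proof.
by move=> Gf; have [Gm _ Fm] := Moeb1_spec; rewrite calF_boxtimes// Fm mulrC.
Qed.

Lemma S_V_Zeta1 f : f \in G1 R -> S_V (f \box zeta) = F f.
Proof.
by move=> Gf; rewrite S_VE ?boxtimes_G1 ?Zeta1_G1// boxtimes_Zeta1K// G1_M1.
Qed.

Lemma boxtimesV_G1 f g : f \in G1 R -> g \in G1 R -> boxtimesV f g \in G1 R.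
Proof. by move=> Gf Gg; rewrite !boxtimes_G1 ?Moeb1_G1. Qed.

Lemma S_V_iso : group_iso (G1 R) (@boxtimesV R) (Lambda R) (@fps_mul R) (@S_V R).
Proof.
have Gm := Moeb1_G1.
apply: group_iso_transport; [exact: Lambda_group|exact: boxtimesV_G1| | | |].
- by move=> f Gf; rewrite S_VE// calF_Lambda ?boxtimes_G1.
- move=> f g Gf Gg; rewrite !S_VE ?boxtimesV_G1// /boxtimesV.
  by rewrite !calF_boxtimes ?boxtimes_G1// fps_mulA.
- move=> f g Gf Gg; rewrite !S_VE// => /(calF_inj (boxtimes_G1 Gf Gm) (boxtimes_G1 Gg Gm)) E.
  by rewrite -(boxtimes_Moeb1K (G1_M1 Gf)) /= E boxtimes_Moeb1K// G1_M1.
move=> u Lu; have [f Gf Ff] := calF_surj Lu; exists (f \box zeta).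
  by rewrite boxtimes_G1 ?Zeta1_G1.
by rewrite S_V_Zeta1.
Qed.

Lemma mul_Zeta1_G1_iso : group_iso (G1 R) (@boxtimes R) (G1 R) (@boxtimesV R) (@mul_Zeta1 R).
Proof.
apply: group_iso_factor calF_iso S_V_iso _ _ => f Gf; last exact: S_V_Zeta1.
exact: boxtimes_G1 Gf Zeta1_G1.
Qed.

Lemma R_V_Zeta1 m : m \in M1 R -> R_V (m \box zeta) = fps_divz m.
Proof. by move=> Mm; rewrite /R_V boxtimes_Zeta1K. Qed.

Lemma M1_add f g : f \in M1 R -> g \in M1 R -> fps_add f g \in M1 R.
Proof. by have [[[clos _ _ _] _] _ _ _ _] := divz_iso; apply: clos. Qed.

Lemma R_V_iso : group_iso (M1 R) (@boxplusV R) (fps_all R) (@fps_add R) (@R_V R).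
Proof.
have [_ _ morphD injD surjD] := divz_iso.
apply: group_iso_transport; first exact: fps_all_group.
- by move=> f g _ _; apply: boxtimes_M1.
- by [].
- by move=> f g Mf Mg; rewrite R_V_Zeta1 ?M1_add ?boxtimes_M1.
- move=> f g Mf Mg /(injD _ _ (boxtimes_M1 _ _) (boxtimes_M1 _ _)) E.
  by rewrite -(boxtimes_Moeb1K Mf) /= E boxtimes_Moeb1K.
move=> u /surjD[m Mm <-]; exists (m \box zeta); first exact: boxtimes_M1.
exact: R_V_Zeta1.
Qed.

Lemma mul_Zeta1_M1_iso : group_iso (M1 R) (@fps_add R) (M1 R) (@boxplusV R) (@mul_Zeta1 R).
Proof.
apply: group_iso_factor divz_iso R_V_iso _ _ => f Mf; last exact: R_V_Zeta1.
exact: boxtimes_M1.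
Qed.

Variable iR : {rmorphism rat -> R}.

Lemma dlog_iso : group_iso (Lambda R) (@fps_mul R) (fps_all R) (@fps_add R) (@dlog R).
Proof.
apply: group_iso_transport; [exact: fps_all_group|exact: LambdaM|by []|exact: dlogM
  |exact: (dlog_inj iR)|].
by move=> u _; apply: (dlog_surj iR).
Qed.

Lemma EXP_spec m : m \in M1 R -> EXP m \in G1 R /\ LOG (EXP m) = m.
Proof.
move=> /M1P m0.
apply: (ClassicalEpsilon.epsilon_spec (inhabits m) (fun f => f \in G1 R /\ LOG f = m)).
(* A preimage under [LOG] is found by lifting [m/z] through [dlog] and then through [F]. *)
have [u Lu Eu] := dlog_surj iR (fps_divz m); have [f Gf Ff] := calF_surj Lu.
by exists f; rewrite /LOG Ff Eu -mulzE mulz_divz.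
Qed.

Lemma EXP_G1 m : m \in M1 R -> EXP m \in G1 R.
Proof. by case/EXP_spec. Qed.

Lemma dlog_calF_EXP m : m \in M1 R -> dlog (calF (EXP m)) = fps_divz m.
Proof. by case/EXP_spec => _ {2}<-. Qed.

Lemma EXP_iso : group_iso (M1 R) (@fps_add R) (G1 R) (@boxtimes R) (@EXP R).
Proof.
exact: group_iso_factor divz_iso (group_iso_comp calF_iso dlog_iso) EXP_G1 dlog_calF_EXP.
Qed.

Lemma EXP_V_G1 m : EXP_V m \in G1 R.
Proof. by rewrite boxtimes_G1 ?Zeta1_G1 ?EXP_G1 ?boxtimes_M1. Qed.

Lemma dlog_S_V_EXP_V m : dlog (S_V (EXP_V m)) = R_V m.
Proof. by rewrite S_V_Zeta1 ?EXP_G1 ?boxtimes_M1// dlog_calF_EXP// boxtimes_M1. Qed.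

Lemma EXP_V_iso : group_iso (M1 R) (@boxplusV R) (G1 R) (@boxtimesV R) (@EXP_V R).
Proof.
apply: group_iso_factor R_V_iso (group_iso_comp S_V_iso dlog_iso) _ _ => m _.
  exact: EXP_V_G1.
exact: dlog_S_V_EXP_V.
Qed.

Lemma EXP_V_Zeta1 m : m \in M1 R -> EXP_V (m \box zeta) = EXP m \box zeta.
Proof. by move=> Mm; rewrite /EXP_V boxtimes_Zeta1K. Qed.

End Isomorphisms.

(** * Naturality *)

Section Naturality.
Variables (R S : comPzRingType) (h : {rmorphism R -> S}).
Implicit Types f g u : fps R.

Local Notation hm := (fps_map h).

Lemma map_add f g : hm (fps_add f g) = fps_add (hm f) (hm g).
Proof. by apply/funext => n; apply: rmorphD. Qed.

Lemma map_mul f g : hm (fps_mul f g) = fps_mul (hm f) (hm g).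
Proof.
apply/funext => n; rewrite /fps_map /fps_mul rmorph_sum.
by apply: eq_bigr => i _; rewrite rmorphM.
Qed.

Lemma map_one : hm (fps_one R) = fps_one S.
Proof. by apply/funext => n; apply: rmorph_nat. Qed.

Lemma map_z : hm (fps_z R) = fps_z S.
Proof. by apply/funext => n; apply: rmorph_nat. Qed.

Lemma map_Zeta1 : hm (Zeta1 R) = Zeta1 S.
Proof. by apply/funext => n; apply: rmorph_nat. Qed.

Lemma map_comp f g : hm (fps_comp f g) = fps_comp (hm f) (hm g).
Proof.
have map_exp k : hm (fps_exp g k) = fps_exp (hm g) k.
  by elim: k => [|k IH]; [exact: map_one|rewrite [LHS]map_mul IH].
apply/funext => n; rewrite /fps_map /fps_comp rmorph_sum.
by apply: eq_bigr => k _; rewrite rmorphM -map_exp.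
Qed.

Lemma map_deriv f : hm (fps_deriv f) = fps_deriv (hm f).
Proof. by apply/funext => n; apply: rmorphMn. Qed.

Lemma map_boxtimes f g : hm (boxtimes f g) = boxtimes (hm f) (hm g).
Proof.
apply/funext => n; rewrite /fps_map /boxtimes; case: ifP => _; last exact: rmorph0.
by rewrite rmorph_sum; apply: eq_bigr => P _; rewrite rmorphM !rmorph_prod.
Qed.

Lemma map_M1 f : f \in M1 R -> hm f \in M1 S.
Proof. by move=> /M1P f0; apply/M1P; rewrite /fps_map f0 rmorph0. Qed.

Lemma map_G1 f : f \in G1 R -> hm f \in G1 S.
Proof. by move=> /G1P[f0 f1]; apply/G1P; rewrite /fps_map f0 f1 rmorph0 rmorph1. Qed.

Lemma map_Lambda u : u \in Lambda R -> hm u \in Lambda S.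
Proof. by move=> /LambdaP u0; apply/LambdaP; rewrite /fps_map u0 rmorph1. Qed.

(** The inverse is a chosen object, so it commutes with [h] through uniqueness: [h] preserves the
    defining equation. *)
Lemma map_calF f : f \in G1 R -> hm (calF f) = calF (hm f).
Proof.
move=> Gf; have [/G1P[c0 _] fc _] := compinv_spec Gf.
rewrite /calF (@compinvP _ (hm f) (hm (fps_compinv f)))//; first exact: map_G1.
  by rewrite /fps_map c0 rmorph0.
by rewrite -map_comp fc map_z.
Qed.

Lemma map_dlog u : u \in Lambda R -> hm (dlog u) = dlog (hm u).
Proof.
move=> Lu; rewrite /dlog map_mul map_deriv; congr fps_mul.
apply: (@inv_unique S (hm u)); last exact/fps_invP/map_Lambda.
by rewrite -[LHS]map_mul (fps_invP Lu : fps_mul _ _ = fps_one _) map_one.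
Qed.

(** Both sides have image [1 + z] under the injective [F]. *)
Lemma map_Moeb1 : hm (Moeb1 R) = Moeb1 S.
Proof.
have [Gm _ Fm] := Moeb1_spec R; have [Gm' _ Fm'] := Moeb1_spec S.
apply: calF_inj => //; first exact: map_G1.
by rewrite -map_calF// Fm Fm' [LHS]map_add map_one map_z.
Qed.

Lemma map_S_V f : f \in G1 R -> hm (S_V f) = S_V (hm f).
Proof.
by move=> Gf; rewrite [LHS]map_mul map_add map_one map_z; congr fps_mul; apply: map_calF.
Qed.

Lemma map_boxtimesV f g : hm (boxtimesV f g) = boxtimesV (hm f) (hm g).
Proof. by rewrite /boxtimesV !map_boxtimes map_Moeb1. Qed.

Lemma map_boxplusV f g : hm (boxplusV f g) = boxplusV (hm f) (hm g).
Proof. by rewrite /boxplusV !(map_boxtimes, map_add) map_Moeb1 map_Zeta1. Qed.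

Lemma map_mul_Zeta1 f : hm (mul_Zeta1 f) = mul_Zeta1 (hm f).
Proof. by rewrite /mul_Zeta1 map_boxtimes map_Zeta1. Qed.

Lemma map_R_V f : hm (R_V f) = R_V (hm f).
Proof. by rewrite /R_V -map_Moeb1 -map_boxtimes. Qed.

Variables (iR : {rmorphism rat -> R}) (iS : {rmorphism rat -> S}).

Lemma map_EXP m : m \in M1 R -> hm (EXP m) = EXP (hm m).
Proof.
move=> Mm; have Mhm := map_M1 Mm; have GE := EXP_G1 iR Mm.
(* [EXP] is again a chosen object; it is pinned down over [S] by injectivity of [dlog] after [F]. *)
have [_ _ _ injS _] := group_iso_comp (calF_iso S) (dlog_iso iS).
apply: injS => /=; [exact: map_G1|exact: EXP_G1|].
rewrite (dlog_calF_EXP iS Mhm) -map_calF// -map_dlog ?calF_Lambda//.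
by rewrite (dlog_calF_EXP iR Mm).
Qed.

Lemma map_EXP_V m : hm (EXP_V m) = EXP_V (hm m).
Proof.
by rewrite /EXP_V map_boxtimes map_EXP ?boxtimes_M1// map_boxtimes map_Moeb1 map_Zeta1.
Qed.

Lemma hom_G1_boxtimes : group_hom (G1 R) (@boxtimes R) (G1 S) (@boxtimes S) hm.
Proof. by split=> [f|f g _ _]; [exact: map_G1|exact: map_boxtimes]. Qed.

Lemma hom_G1_boxtimesV : group_hom (G1 R) (@boxtimesV R) (G1 S) (@boxtimesV S) hm.
Proof. by split=> [f|f g _ _]; [exact: map_G1|exact: map_boxtimesV]. Qed.

Lemma hom_Lambda_mul : group_hom (Lambda R) (@fps_mul R) (Lambda S) (@fps_mul S) hm.
Proof. by split=> [f|f g _ _]; [exact: map_Lambda|exact: map_mul]. Qed.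

Lemma hom_all_add : group_hom (fps_all R) (@fps_add R) (fps_all S) (@fps_add S) hm.
Proof. by split=> // f g _ _; apply: map_add. Qed.

Lemma hom_M1_add : group_hom (M1 R) (@fps_add R) (M1 S) (@fps_add S) hm.
Proof. by split=> [f|f g _ _]; [exact: map_M1|exact: map_add]. Qed.

Lemma hom_M1_boxplusV : group_hom (M1 R) (@boxplusV R) (M1 S) (@boxplusV S) hm.
Proof. by split=> [f|f g _ _]; [exact: map_M1|exact: map_boxplusV]. Qed.

End Naturality.

Theorem theorem7p8 :
  [/\ natural_group_iso G1 boxtimes Lambda fps_mul calF,
      natural_group_iso G1 boxtimesV Lambda fps_mul S_V,
      natural_group_iso Lambda fps_mul fps_all fps_add dlog &
      natural_group_iso G1 boxtimes G1 boxtimesV mul_Zeta1] /\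
  [/\ natural_group_iso M1 fps_add M1 boxplusV mul_Zeta1,
      natural_group_iso M1 boxplusV fps_all fps_add R_V,
      natural_group_iso M1 fps_add G1 boxtimes EXP &
      natural_group_iso M1 boxplusV G1 boxtimesV EXP_V] /\
  forall (R : comPzRingType) (iR : {rmorphism rat -> R}) (f m : fps R),
    f \in G1 R -> m \in M1 R ->
    [/\ S_V (boxtimes f (Zeta1 R)) = calF f,
        R_V (boxtimes m (Zeta1 R)) = fps_divz m,
        dlog (calF (EXP m)) = fps_divz m,
        dlog (S_V (EXP_V m)) = R_V m &
        EXP_V (boxtimes m (Zeta1 R)) = boxtimes (EXP m) (Zeta1 R)].
Proof.
have hG := hom_G1_boxtimes; have hGV := hom_G1_boxtimesV; have hL := hom_Lambda_mul.
have hA := hom_all_add; have hM := hom_M1_add; have hMV := hom_M1_boxplusV.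
split; last split; last first.
- move=> R iR f m Gf Mm; split.
  + exact: S_V_Zeta1.
  + exact: R_V_Zeta1.
  + exact: dlog_calF_EXP.
  + exact: dlog_S_V_EXP_V.
  + exact: EXP_V_Zeta1.
- split; split=> [R iR|R S iR iS h].
  + exact: mul_Zeta1_M1_iso.
  + by split=> // f _; apply: map_mul_Zeta1.
  + exact: R_V_iso.
  + by split=> // f _; apply: map_R_V.
  + exact: EXP_iso.
  + by split=> // f Mf; apply: map_EXP.
  + exact: EXP_V_iso.
  + by split=> // f _; apply: map_EXP_V.
- split; split=> [R iR|R S iR iS h].
  + exact: calF_iso.
  + by split=> // f Gf; apply: map_calF.
  + exact: S_V_iso.
  + by split=> // f Gf; apply: map_S_V.
  + exact: dlog_iso.
  + by split=> // u Lu; apply: map_dlog.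
  + exact: mul_Zeta1_G1_iso.
  + by split=> // f _; apply: map_mul_Zeta1.
Qed.
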